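(* Let $k\ge2$ be an integer and $m,p\in\mathbb{N}$ with $m\le p$. Suppose that $f=h+\overline{g}$ is harmonic in $\mathbb{D}$, where $h(z)=\sum_{n=k}^{\infty}a_{pn+m}z^{pn+m}$ and $g(z)=\sum_{n=k}^{\infty}b_{pn+m}z^{pn+m}$, and $h,g\in\mathcal{B}_{pk+m}$. Define $$M^1_{pk+m}(h,r)=\sum_{n=k}^{\infty}|a_{pn+m}|r^{pn+m}+\left(\frac1{1+|a_{pk+m}|}+\frac{r^p}{1-r^p}\right)\sum_{n=k+1}^{\infty}|a_{pn+m}|^2r^{p(2n-k)+m},$$ and define $M^1_{pk+m}(g,r)$ by the same formula with the coefficients $b_{pn+m}$ of $g$ in place of $a_{pn+m}$. Then the inequality $$M^1_{pk+m}(h,r)+M^1_{pk+m}(g,r)\le1$$ is valid for $r\in[0,\tau_k]$, where $\tau_k$ is the unique root in $(0,1)$ of the equation $$2(1-r^p)-r^{p(k-1)+m}(5r^{2p}-2r^p+1)=0.$$ The upper bound $\tau_k$ cannot be improved.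
   Context: $\mathbb{D}=\{z\in\mathbb{C}:|z|<1\}$ and $\mathbb N=\{1,2,\dots\}$. $\mathcal{B}$ is the class of analytic functions $\phi$ on $\mathbb{D}$ with $\sup_{z\in\mathbb{D}}|\phi(z)|\le1$, and for $j\in\mathbb{N}$, $\mathcal{B}_j=\{\phi\in\mathcal{B}:\phi(0)=\cdots=\phi^{(j-1)}(0)=0\}$. ''Cannot be improved'' means that $\tau_k$ cannot be replaced by any larger number in $(0,1)$ so that the inequality still holds for all such $f$. *)

(* Defs.v *)
(* Stdlib reals and Coquelicot. *)
From Stdlib Require Import Reals.
From Coquelicot Require Import Coquelicot.
Open Scope R_scope.

Definition in_disc (z : C) : Prop := Cmod z < 1.

(* Functions on the disc are total functions [C -> C] whose values outside the
   disc are never used.  [ex_derive] is complex differentiability: the scalars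
   are [C_AbsRing]. *)
Definition analytic_in_disc (h : C -> C) : Prop :=
  forall z : C, in_disc z -> ex_derive (K := C_AbsRing) (V := C_NormedModule) h z.

Definition class_B (h : C -> C) : Prop :=
  analytic_in_disc h /\ forall z : C, in_disc z -> Cmod (h z) <= 1.

(* [C_derive] is defined by a limit along the horizontal line through the point;
   it is the complex derivative wherever that exists, hence everywhere in the
   disc for all iterates when [h] is analytic there. *)
Definition C_derive_n (n : nat) (h : C -> C) : C -> C := Nat.iter n C_derive h.

Definition class_Bj (j : nat) (h : C -> C) : Prop :=
  class_B h /\ forall i : nat, (i < j)%nat -> C_derive_n i h (RtoC 0) = RtoC 0.

Definition partial_x (u : C -> R) (z : C) : R :=
  Derive (fun t : R => u (t, Im z)) (Re z).
Definition partial_y (u : C -> R) (z : C) : R :=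
  Derive (fun t : R => u (Re z, t)) (Im z).

Definition C1_in_disc (u : C -> R) : Prop :=
  forall z : C, in_disc z ->
    ex_derive (fun t : R => u (t, Im z)) (Re z) /\
    ex_derive (fun t : R => u (Re z, t)) (Im z) /\
    continuous (partial_x u) z /\
    continuous (partial_y u) z.

Definition real_harmonic_in_disc (u : C -> R) : Prop :=
  C1_in_disc u /\ C1_in_disc (partial_x u) /\ C1_in_disc (partial_y u) /\
  forall z : C, in_disc z ->
    partial_x (partial_x u) z + partial_y (partial_y u) z = 0.

Definition harmonic_in_disc (f : C -> C) : Prop :=
  real_harmonic_in_disc (fun z => Re (f z)) /\
  real_harmonic_in_disc (fun z => Im (f z)).

(* Only the coefficients [a (p * n + m)] with [k <= n] are ever used. *)
Definition has_expansion (k m p : nat) (a : nat -> C) (h : C -> C) : Prop :=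
  forall z : C, in_disc z ->
    is_series (K := C_AbsRing) (V := C_NormedModule)
      (fun j : nat =>
         Cmult (a (p * (k + j) + m)%nat) (Cpow z (p * (k + j) + m))) (h z).

Definition admissible (k m p : nat) (a b : nat -> C) (f h g : C -> C) : Prop :=
  harmonic_in_disc f /\
  (forall z : C, in_disc z -> f z = Cplus (h z) (Cconj (g z))) /\
  has_expansion k m p a h /\
  has_expansion k m p b g /\
  class_Bj (p * k + m) h /\
  class_Bj (p * k + m) g.

Definition series_from (n0 : nat) (u : nat -> R) : R :=
  Series (fun j : nat => u (n0 + j)%nat).

(* Used only for [0 <= r < 1] and for coefficients of functions bounded by 1 in
   the disc; these have modulus at most 1, so both series converge.  In the
   second sum [k < n], so the subtraction on [nat] is exact. *)
Definition M1 (k m p : nat) (a : nat -> C) (r : R) : R :=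
  series_from k (fun n => Cmod (a (p * n + m)%nat) * r ^ (p * n + m)) +
  (1 / (1 + Cmod (a (p * k + m)%nat)) + r ^ p / (1 - r ^ p)) *
  series_from (k + 1)
    (fun n => Cmod (a (p * n + m)%nat) ^ 2 * r ^ (p * (2 * n - k) + m)).

(* The inequality for all admissible functions and all radii in [0, rho]. *)
Definition bohr_inequality_upto (k m p : nat) (rho : R) : Prop :=
  forall (a b : nat -> C) (f h g : C -> C),
    admissible k m p a b f h g ->
    forall r : R, 0 <= r <= rho -> M1 k m p a r + M1 k m p b r <= 1.

Definition is_root_tau (k m p : nat) (t : R) : Prop :=
  0 < t < 1 /\
  2 * (1 - t ^ p) - t ^ (p * (k - 1) + m) * (5 * t ^ (2 * p) - 2 * t ^ p + 1) = 0.

(* Main.v *)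
(** Write [h z = z^J * phi (z^p)] with [J = p * k + m] and [phi w = sum c_j w^j]
bounded by 1.  Averaging [phi * X^2] over roots of unity shows that the Hankel
matrices [c (N - i - j)] are contractive; a suitable test vector then gives
Carlson's inequalities
[|c_(2n+1)| <= 1 - A_n] and [|c_(2n+2)| <= 1 - A_n - |c_(n+1)|^2 / (1 + |c_0|)],
where [A_n = |c_0|^2 + ... + |c_n|^2].  Summed against [x^j], [x = r^p], they
telescope to [M1 h r <= r^J (|c_0| + (1 - |c_0|^2) x / (1 - x))], whose maximum over
[|c_0|] is [r^J (5 x^2 - 2 x + 1) / (4 x (1 - x))], attained at [(1 - x) / (2 x)].
Doubling this and comparing with 1 gives the equation of [tau_k].  The bound is an
equality for [phi w = (al - w) / (1 - al w)], and [(1 - x) / (2 x)] lies in [[0, 1)]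
for [x > 1/3], which holds from [tau_k] on; taking both [h] and [g] to be this
function shows sharpness. *)

Require Import Defs.
From Stdlib Require Import Reals Lra Lia Psatz.
From Coquelicot Require Import Coquelicot.
Open Scope R_scope.

(** * Averages over roots of unity *)

(** The coefficient of w^N in phi * X^2, where X = sum x_i w^i, is the form sum x_i x_i' c (N - i -
    i'), and its modulus is at most the mean of |X|^2, that is sum |x_i|^2. When the upper half of x
    holds conjugates of coefficients, row 0 and column 0 each contribute A_n to the form while the
    norm contains A_n only once; with c_N rotated to be nonnegative this reads |c_N| + 2 A_n <= 1 +
    A_n. For even N there is a middle index, and its free entry produces the term with 1 / (1 +
    |c_0|), which is exactly the weight in the definition of M1.

    Means are sums over equally spaced points, exact for trigonometric polynomials of low degree, so
    no integral occurs. The price is that phi must be truncated, and its partial sums need not be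
    bounded by 1. The estimate is therefore proved with a general bound K, on circles of radius
    below 1 where partial sums converge uniformly, and the radius tends to 1 last. *)

Definition Csum (u : nat -> C) (n : nat) : C := sum_n (G := C_AbelianMonoid) u n.

Lemma Csum_O u : Csum u 0 = u 0%nat.
Proof. exact (sum_O _). Qed.

Lemma Csum_S u n : Csum u (S n) = (Csum u n + u (S n))%C.
Proof. exact (sum_Sn _ _). Qed.

Lemma Csum_ext u v n :
  (forall i, (i <= n)%nat -> u i = v i) -> Csum u n = Csum v n.
Proof. exact (sum_n_ext_loc _ _ _). Qed.

Lemma Csum_plus u v n :
  Csum (fun i => u i + v i)%C n = (Csum u n + Csum v n)%C.
Proof. exact (sum_n_plus _ _ _). Qed.

Lemma Csum_mult_l a u n : Csum (fun i => a * u i)%C n = (a * Csum u n)%C.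
Proof. exact (sum_n_mult_l (K := C_Ring) a u n). Qed.

Lemma Csum_mult_r a u n : Csum (fun i => u i * a)%C n = (Csum u n * a)%C.
Proof. exact (sum_n_mult_r (K := C_Ring) a u n). Qed.

Lemma Csum_switch u m n :
  Csum (fun i => Csum (u i) n) m = Csum (fun j => Csum (fun i => u i j) m) n.
Proof. exact (sum_n_switch _ _ _). Qed.

Lemma Csum_RtoC u n : Csum (fun i => RtoC (u i)) n = RtoC (sum_f_R0 u n).
Proof.
induction n as [|n IH]; simpl.
- apply Csum_O.
- now rewrite Csum_S, IH, RtoC_plus.
Qed.

Lemma Cmod_Csum u n : Cmod (Csum u n) <= sum_f_R0 (fun i => Cmod (u i)) n.
Proof.
induction n as [|n IH]; simpl.
- rewrite Csum_O. lra.
- rewrite Csum_S. eapply Rle_trans; [apply Cmod_triangle|]. lra.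
Qed.

Lemma Csum_conj u n : Cconj (Csum u n) = Csum (fun i => Cconj (u i)) n.
Proof.
induction n as [|n IH].
- now rewrite !Csum_O.
- now rewrite !Csum_S, Cplus_conj, IH.
Qed.

Lemma Csum_zero u n : (forall i, (i <= n)%nat -> u i = RtoC 0) -> Csum u n = RtoC 0.
Proof.
intros H; induction n as [|n IH].
- rewrite Csum_O; auto.
- rewrite Csum_S, IH, H by (intros; try apply H; lia). ring.
Qed.

Lemma Csum_single u n j :
  (j <= n)%nat -> (forall i, (i <= n)%nat -> i <> j -> u i = RtoC 0) ->
  Csum u n = u j.
Proof.
intros Hj H; induction n as [|n IH].
- rewrite Csum_O. f_equal; lia.
- rewrite Csum_S. destruct (Nat.eq_dec j (S n)) as [->|Hn].
  + rewrite Csum_zero; [ring|]. intros i Hi; apply H; lia.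
  + rewrite IH, (H (S n)); [ring|lia|lia|lia|]. intros; apply H; lia.
Qed.

Lemma Csum_mult u v n1 n2 :
  (Csum u n1 * Csum v n2)%C = Csum (fun i => Csum (fun j => u i * v j)%C n2) n1.
Proof.
rewrite <- Csum_mult_r. apply Csum_ext; intros i _. now rewrite Csum_mult_l.
Qed.

Definition cis (t : R) : C := (cos t, sin t).

Lemma cis_0 : cis 0 = RtoC 1.
Proof. unfold cis. now rewrite cos_0, sin_0. Qed.

Lemma cis_plus s t : cis (s + t) = (cis s * cis t)%C.
Proof. unfold cis, Cmult; simpl. rewrite cos_plus, sin_plus. f_equal; ring. Qed.

Lemma cis_pow t n : (cis t ^ n)%C = cis (INR n * t).
Proof.
induction n as [|n IH].
- simpl. now rewrite Rmult_0_l, cis_0.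
- rewrite Cpow_S, IH, <- cis_plus, S_INR. f_equal; ring.
Qed.

Lemma cis_conj t : Cconj (cis t) = cis (- t).
Proof. unfold cis, Cconj; simpl. now rewrite cos_neg, sin_neg. Qed.

Lemma Cmod_cis t : Cmod (cis t) = 1.
Proof.
unfold cis, Cmod; simpl.
replace (_ + _) with 1; [apply sqrt_1|].
generalize (sin2_cos2 t); unfold Rsqr; lra.
Qed.

Lemma cis_neq_1 t : 0 < Rabs t < 2 * PI -> cis t <> RtoC 1.
Proof.
assert (Hpos : forall s, 0 < s < 2 * PI -> cos s <> 1).
{ intros s Hs Hc.
  assert (Hsin : 0 < sin (s / 2)) by (apply sin_gt_0; lra).
  replace s with (2 * (s / 2)) in Hc by lra.
  rewrite cos_2a_sin in Hc. nra. }
intros Ht Hc. apply (f_equal fst) in Hc; simpl in Hc.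
revert Ht Hc; unfold Rabs; destruct (Rcase_abs t); intros Ht Hc.
- apply (Hpos (- t) Ht). now rewrite cos_neg.
- now apply (Hpos t Ht).
Qed.

Lemma Csum_geom (u : C) n : ((u - 1) * Csum (fun j => u ^ j) n)%C = (u ^ S n - 1)%C.
Proof.
induction n as [|n IH].
- rewrite Csum_O. simpl. ring.
- rewrite Csum_S, Cmult_plus_distr_l, IH, !Cpow_S. ring.
Qed.

(** Arguments of the roots of unity of order M + 1, the number of terms of [Csum _ M]. *)
Definition root_arg (M j : nat) : R := INR j * (2 * PI / INR (S M)).

(** The hypotheses say |a - b| <= M, so distinct frequencies are never congruent modulo M + 1: then
    u is a root of unity other than 1, and its geometric sum vanishes. *)
Lemma cis_orthogonal (M a b : nat) :
  (a <= b + M)%nat -> (b <= a + M)%nat ->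
  Csum (fun j => cis ((INR a - INR b) * root_arg M j)) M =
  if Nat.eqb a b then RtoC (INR (S M)) else RtoC 0.
Proof.
intros Hab Hba.
set (u := cis ((INR a - INR b) * (2 * PI / INR (S M)))).
assert (HM : 0 < INR (S M)) by (apply lt_0_INR; lia).
assert (Hu : Csum (fun j => cis ((INR a - INR b) * root_arg M j)) M =
             Csum (fun j => u ^ j)%C M).
{ apply Csum_ext; intros j _. unfold u, root_arg. rewrite cis_pow. f_equal; ring. }
rewrite Hu. destruct (Nat.eqb_spec a b) as [E|E].
- subst u b. rewrite Rminus_diag, Rmult_0_l, cis_0 in *.
  rewrite (Csum_ext _ (fun _ => RtoC 1)) by (intros; apply Cpow_1_l).
  rewrite Csum_RtoC, sum_cte. now rewrite Rmult_1_l.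
- assert (Hu1 : u <> RtoC 1).
  { apply cis_neq_1.
    assert (Hpi := PI_RGT_0).
    rewrite Rabs_mult, (Rabs_right (2 * PI / INR (S M)))
      by (apply Rle_ge, Rlt_le, Rdiv_lt_0_compat; lra).
    assert (Hd : 0 < Rabs (INR a - INR b) < INR (S M)).
    { split.
      - apply Rabs_pos_lt. intros H. apply E, INR_eq. lra.
      - apply le_INR in Hab, Hba. rewrite plus_INR in Hab, Hba. rewrite S_INR.
        unfold Rabs; destruct Rcase_abs; lra. }
    split.
    - apply Rmult_lt_0_compat; [lra|]. apply Rdiv_lt_0_compat; lra.
    - replace (2 * PI) with (INR (S M) * (2 * PI / INR (S M))) at 2 by (field; lra).
      apply Rmult_lt_compat_r; [|lra]. apply Rdiv_lt_0_compat; lra. }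
  assert (HuM : (u ^ S M)%C = RtoC 1).
  { unfold u. rewrite cis_pow.
    replace (INR (S M) * _) with ((INR a - INR b) * (2 * PI)) by (field; lra).
    rewrite (Rmult_comm (INR a - INR b)).
    unfold cis.
    destruct (Nat.le_ge_cases b a) as [L|L].
    - rewrite <- minus_INR by lia.
      replace (2 * PI * INR (a - b)) with (0 + 2 * INR (a - b) * PI) by ring.
      now rewrite cos_period, sin_period, cos_0, sin_0.
    - replace (2 * PI * (INR a - INR b)) with (- (0 + 2 * INR (b - a) * PI))
        by (rewrite minus_INR by lia; ring).
      now rewrite cos_neg, sin_neg, cos_period, sin_period, cos_0, sin_0, Ropp_0. }
  generalize (Csum_geom u M). rewrite HuM.
  replace (1 - 1)%C with (RtoC 0) by ring. intros H.
  destruct (Ceq_dec (Csum (fun j => u ^ j)%C M) (RtoC 0)) as [|Hn]; [assumption|].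
  exfalso. revert H; apply Cmult_neq_0; [|exact Hn].
  intros H1. apply Hu1. replace u with (u - 1 + 1)%C by ring. rewrite H1. ring.
Qed.

Definition on_circle (rho t : R) : C := (rho * cis t)%C.

Lemma on_circle_pow rho t n : (on_circle rho t ^ n)%C = (RtoC (rho ^ n) * cis (INR n * t))%C.
Proof. unfold on_circle. now rewrite Cpow_mult_l, cis_pow, <- RtoC_pow. Qed.

Lemma Cmod_on_circle rho t : 0 <= rho -> Cmod (on_circle rho t) = rho.
Proof.
intros H. unfold on_circle. rewrite Cmod_mult, Cmod_cis, Cmod_R, Rabs_right; lra.
Qed.

(* The entries of the Hankel matrix [c (N - s)], extended by [0] to [s > N],
   where the subtraction on [nat] would be truncated. *)
Definition hankel (c : nat -> C) (N s : nat) : C :=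
  if Nat.leb s N then c (N - s)%nat else RtoC 0.

(** The average keeps only the term l = N - s. [N <= L] puts that term inside the truncated sum, and
    the lower bound on M prevents any other frequency l + s from aliasing to N. *)
Lemma circle_average_coeff (c : nat -> C) (N L s M : nat) (rho : R) :
  (N <= L)%nat -> (L + s + N <= M)%nat ->
  Csum (fun j => Csum (fun l => c l * on_circle rho (root_arg M j) ^ l) L *
                 on_circle rho (root_arg M j) ^ s *
                 cis (- (INR N * root_arg M j)))%C M =
  (INR (S M) * rho ^ N * hankel c N s)%C.
Proof.
intros HL HM.
transitivity (Csum (fun l => Csum (fun j =>
  c l * RtoC (rho ^ (l + s)) * cis ((INR (l + s) - INR N) * root_arg M j)) M) L)%C.
{ rewrite <- Csum_switch. apply Csum_ext; intros j _.
  rewrite <- !Csum_mult_r. apply Csum_ext; intros l _.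
  rewrite <- Cmult_assoc, <- Cmult_assoc, <- Cmult_assoc. f_equal.
  rewrite Cmult_assoc, <- Cpow_add_r, on_circle_pow, <- Cmult_assoc, <- cis_plus.
  do 2 f_equal. ring. }
unfold hankel. destruct (Nat.leb_spec s N) as [H|H].
- rewrite (Csum_single _ L (N - s)).
  + rewrite Csum_mult_l, cis_orthogonal by lia.
    replace (N - s + s)%nat with N by lia. rewrite Nat.eqb_refl, RtoC_pow. ring.
  + lia.
  + intros l Hl Hn. rewrite Csum_mult_l, cis_orthogonal by lia.
    destruct (Nat.eqb_spec (l + s) N); [lia|ring].
- rewrite Csum_zero; [ring|].
  intros l Hl. rewrite Csum_mult_l, cis_orthogonal by lia.
  destruct (Nat.eqb_spec (l + s) N); [lia|ring].
Qed.

(** Discrete Parseval identity: the off-diagonal terms of the expanded square vanish by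
    orthogonality. *)
Lemma circle_average_norm (x : nat -> C) (N M : nat) (rho : R) :
  (N <= M)%nat ->
  sum_f_R0 (fun j => Cmod (Csum (fun i => x i * on_circle rho (root_arg M j) ^ i)%C N) ^ 2) M =
  INR (S M) * sum_f_R0 (fun i => Cmod (x i) ^ 2 * (rho ^ i) ^ 2) N.
Proof.
intros HM. apply RtoC_inj. rewrite RtoC_mult, <- !Csum_RtoC.
transitivity (Csum (fun i => Csum (fun i' => Csum (fun j =>
  x i * Cconj (x i') * RtoC (rho ^ i) * RtoC (rho ^ i') *
    cis ((INR i - INR i') * root_arg M j)) M) N) N)%C.
{ transitivity (Csum (fun j => Csum (fun i => Csum (fun i' =>
    x i * Cconj (x i') * RtoC (rho ^ i) * RtoC (rho ^ i') *
    cis ((INR i - INR i') * root_arg M j)) N) N) M)%C.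
  - apply Csum_ext; intros j _. rewrite Cmod2_conj, Csum_conj, Csum_mult.
    apply Csum_ext; intros i _. apply Csum_ext; intros i' _.
    rewrite Cmult_conj, Cpow_conj. unfold on_circle at 2.
    rewrite Cmult_conj, cis_conj.
    replace (Cconj rho * cis (- root_arg M j))%C with (on_circle rho (- root_arg M j)).
    2: { unfold on_circle. f_equal. unfold Cconj, RtoC; simpl. now rewrite Ropp_0. }
    rewrite !on_circle_pow.
    replace ((INR i - INR i') * root_arg M j)
      with (INR i * root_arg M j + INR i' * - root_arg M j) by ring.
    rewrite cis_plus. ring.
  - rewrite Csum_switch. apply Csum_ext; intros i _. now rewrite Csum_switch. }
rewrite <- Csum_mult_l. apply Csum_ext; intros i Hi.
rewrite (Csum_single _ N i Hi).
- rewrite Csum_mult_l, cis_orthogonal by lia.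
  rewrite Nat.eqb_refl, RtoC_mult, Cmod2_conj.
  rewrite (RtoC_pow (rho ^ i)). ring.
- intros i' Hi' Hn. rewrite Csum_mult_l, cis_orthogonal by lia.
  destruct (Nat.eqb_spec i i'); [lia|ring].
Qed.

Lemma hankel_form_polynomial (c x : nat -> C) (N L : nat) (rho K : R) :
  0 <= rho <= 1 -> (N <= L)%nat ->
  (forall t, Cmod (Csum (fun l => c l * on_circle rho t ^ l)%C L) <= K) ->
  rho ^ N * Cmod (Csum (fun i => Csum (fun i' => x i * x i' * hankel c N (i + i')) N) N)%C
  <= K * sum_f_R0 (fun i => Cmod (x i) ^ 2) N.
Proof.
intros Hrho HL HK.
assert (HK0 : 0 <= K) by (eapply Rle_trans; [apply Cmod_ge_0|apply (HK 0)]).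
(* Enough points for [circle_average_coeff] at every s = i + i' <= 2 * N. *)
set (M := (L + (N + N) + N)%nat).
set (w := fun j => on_circle rho (root_arg M j)).
set (X := fun j => Csum (fun i => x i * w j ^ i)%C N).
assert (HM : 0 < INR (S M)) by (apply lt_0_INR; lia).
apply Rmult_le_reg_l with (1 := HM).
set (Q := (Csum (fun i => Csum (fun i' => x i * x i' * hankel c N (i + i')) N) N)%C).
replace (INR (S M) * (rho ^ N * Cmod Q)) with (Cmod (INR (S M) * RtoC rho ^ N * Q)%C).
2: { rewrite !Cmod_mult, <- RtoC_pow, !Cmod_R, !Rabs_right; [ring| |lra].
     apply Rle_ge, pow_le; lra. }
replace (INR (S M) * RtoC rho ^ N * Q)%C with
  (Csum (fun j => Csum (fun l => c l * w j ^ l) L * (X j * X j) *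
                 cis (- (INR N * root_arg M j))) M)%C.
2: { transitivity (Csum (fun i => Csum (fun i' => x i * x i' *
       Csum (fun j => Csum (fun l => c l * w j ^ l) L * w j ^ (i + i') *
                 cis (- (INR N * root_arg M j))) M) N) N)%C.
     - transitivity (Csum (fun i => Csum (fun j => Csum (fun i' => x i * x i' *
         (Csum (fun l => c l * w j ^ l) L * w j ^ (i + i') *
                 cis (- (INR N * root_arg M j)))) N) M) N)%C.
       + rewrite <- Csum_switch. apply Csum_ext; intros j _.
         unfold X. rewrite Csum_mult, (Cmult_comm _ (Csum _ N)), <- !Csum_mult_r.
         apply Csum_ext; intros i _. rewrite <- !Csum_mult_r.
         apply Csum_ext; intros i' _. rewrite Cpow_add_r. ring.
       + apply Csum_ext; intros i _. rewrite Csum_switch.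
         apply Csum_ext; intros i' _. now rewrite Csum_mult_l.
     - unfold Q. rewrite <- Csum_mult_l. apply Csum_ext; intros i Hi.
       rewrite <- Csum_mult_l. apply Csum_ext; intros i' Hi'.
       unfold w. rewrite circle_average_coeff by (unfold M; lia). ring. }
eapply Rle_trans; [apply Cmod_Csum|].
apply Rle_trans with (sum_f_R0 (fun j => Cmod (X j) ^ 2 * K) M).
- apply sum_Rle; intros j _. rewrite !Cmod_mult, Cmod_cis.
  assert (H := HK (root_arg M j)). fold (w j) in H.
  assert (H0 := Cmod_ge_0 (X j)). nra.
- rewrite <- scal_sum. unfold X, w. rewrite circle_average_norm by (unfold M; lia).
  replace (INR (S M) * (K * sum_f_R0 (fun i => Cmod (x i) ^ 2) N)) with
    (K * (INR (S M) * sum_f_R0 (fun i => Cmod (x i) ^ 2) N)) by ring.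
  apply Rmult_le_compat_l; [exact HK0|]. apply Rmult_le_compat_l; [lra|].
  apply sum_Rle; intros i _.
  assert (H1 : 0 <= rho ^ i <= 1).
  { split; [apply pow_le; lra|]. rewrite <- (pow1 i). apply pow_incr; lra. }
  assert (H2 : 0 <= Cmod (x i) ^ 2) by apply pow2_ge_0. assert (H3 : (rho ^ i) ^ 2 <= 1) by nra. cbv beta. nra.
Qed.

(** * From polynomials to power series *)

Lemma is_series_C_iff (a : nat -> C) (s : C) :
  is_series (K := C_AbsRing) (V := C_NormedModule) a s <->
  forall eps, 0 < eps -> exists n0, forall n, (n0 <= n)%nat -> Cmod (Csum a n - s)%C < eps.
Proof.
split.
- intros H eps Heps.
  destruct (proj1 (filterlim_locally_ball_norm (K := C_AbsRing) (U := C_NormedModule) _ _) H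
              (mkposreal eps Heps)) as [n0 Hn0].
  now exists n0.
- intros H. apply filterlim_locally_ball_norm. intros eps.
  destruct (H eps (cond_pos eps)) as [n0 Hn0]. now exists n0.
Qed.

Lemma Csum_diff_le (a : nat -> C) n d :
  Cmod (Csum a n - Csum a (n + d))%C <=
  sum_f_R0 (fun i => Cmod (a i)) (n + d) - sum_f_R0 (fun i => Cmod (a i)) n.
Proof.
induction d as [|d IH].
- rewrite Nat.add_0_r, Rminus_diag. replace (_ - _)%C with (RtoC 0) by ring.
  rewrite Cmod_0. lra.
- rewrite Nat.add_succ_r, Csum_S. simpl sum_f_R0.
  replace (_ - _)%C with (Csum a n - Csum a (n + d) + - a (S (n + d)))%C by ring.
  eapply Rle_trans; [apply Cmod_triangle|]. rewrite Cmod_opp. lra.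
Qed.

(** On a circle the series of moduli depends on the radius alone, so this bound makes the truncation
    error uniform in the angle. *)
Lemma is_series_tail_le (a : nat -> C) (s : C) (S : R) (n : nat) :
  is_series (K := C_AbsRing) (V := C_NormedModule) a s ->
  is_series (fun i => Cmod (a i)) S ->
  Cmod (Csum a n - s)%C <= S - sum_f_R0 (fun i => Cmod (a i)) n.
Proof.
intros Ha HS. apply le_epsilon; intros eps Heps.
destruct (proj1 (is_series_C_iff a s) Ha eps Heps) as [n0 Hn0].
specialize (Hn0 (n + n0)%nat ltac:(lia)).
replace (Csum a n - s)%C with
  (Csum a n - Csum a (n + n0) + (Csum a (n + n0) - s))%C by ring.
eapply Rle_trans; [apply Cmod_triangle|].
assert (H1 := Csum_diff_le a n n0).
assert (H2 : sum_f_R0 (fun i => Cmod (a i)) (n + n0) <= S).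
{ rewrite <- sum_n_Reals.
  apply (is_lim_seq_incr_compare (sum_n (fun i => Cmod (a i)))); [exact HS|].
  intros j. rewrite sum_Sn. assert (H := Cmod_ge_0 (a (Datatypes.S j))).
  unfold plus; simpl. lra. }
lra.
Qed.

Lemma term_le_sum (u : nat -> R) n i :
  (forall j, 0 <= u j) -> (i <= n)%nat -> u i <= sum_f_R0 u n.
Proof.
intros Hu; induction n as [|n IH]; intros Hi; simpl.
- replace i with 0%nat by lia. lra.
- assert (H := cond_pos_sum u n Hu). assert (H' := Hu (S n)).
  destruct (Nat.eq_dec i (S n)) as [->|Hn]; [lra|].
  assert (H2 := IH ltac:(lia)). lra.
Qed.

Lemma is_series_C_bounded (a : nat -> C) (s : C) :
  is_series (K := C_AbsRing) (V := C_NormedModule) a s ->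
  exists B, forall n, Cmod (a n) <= B.
Proof.
intros H. destruct (proj1 (is_series_C_iff a s) H 1 Rlt_0_1) as [n0 Hn0].
assert (Hpos : forall j, 0 <= Cmod (a j)) by (intros; apply Cmod_ge_0).
exists (sum_f_R0 (fun i => Cmod (a i)) n0 + 2). intros n.
destruct (Nat.le_gt_cases n n0) as [L|L].
- assert (H1 := term_le_sum (fun i => Cmod (a i)) n0 n Hpos L). cbv beta in H1. lra.
- destruct n as [|n]; [lia|].
  assert (H1 := Hn0 n ltac:(lia)). assert (H2 := Hn0 (S n) ltac:(lia)).
  assert (H3 := cond_pos_sum _ n0 Hpos).
  replace (a (S n)) with ((Csum a (S n) - s) + - (Csum a n - s))%C
    by (rewrite Csum_S; ring).
  eapply Rle_trans; [apply Cmod_triangle|]. rewrite Cmod_opp. lra.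
Qed.

(** Abel's lemma: the terms at r1 are bounded, hence those at r are dominated by a geometric series
    of ratio r / r1. *)
Lemma abs_convergence_inside (c : nat -> C) (r r1 : R) (s : C) :
  0 <= r < r1 ->
  is_series (K := C_AbsRing) (V := C_NormedModule) (fun l => c l * r1 ^ l)%C s ->
  ex_series (fun l => Cmod (c l) * r ^ l).
Proof.
intros Hr H. destruct (is_series_C_bounded _ _ H) as [B HB].
apply (ex_series_le (K := R_AbsRing) (V := R_CompleteNormedModule)) with (b := fun l => B * (r / r1) ^ l).
- intros l. specialize (HB l).
  rewrite Cmod_mult, Cmod_pow, Cmod_R, Rabs_right in HB by lra.
  change (Rabs (Cmod (c l) * r ^ l) <= B * (r / r1) ^ l).
  assert (Hrl : 0 <= r ^ l) by (apply pow_le; lra).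
  assert (Hrl1 : 0 < r1 ^ l) by (apply pow_lt; lra).
  rewrite Rabs_right by (apply Rle_ge, Rmult_le_pos; [apply Cmod_ge_0|assumption]).
  unfold Rdiv. rewrite Rpow_mult_distr, pow_inv.
  replace (Cmod (c l) * r ^ l) with (Cmod (c l) * r1 ^ l * (r ^ l * / r1 ^ l))
    by (field; lra).
  apply Rmult_le_compat_r; [|assumption].
  apply Rmult_le_pos; [assumption|]. apply Rlt_le, Rinv_0_lt_compat; assumption.
- apply (ex_series_scal_l (K := R_AbsRing) B (fun l => (r / r1) ^ l)). apply ex_series_geom.
  rewrite Rabs_right; [|apply Rle_ge, Rdiv_le_0_compat; lra].
  apply Rmult_lt_reg_r with r1; [lra|]. field_simplify; lra.
Qed.

Lemma hankel_form_circle (c x : nat -> C) (N : nat) (r K : R) :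
  0 <= r <= 1 ->
  ex_series (fun l => Cmod (c l) * r ^ l) ->
  (forall t, exists s,
     is_series (K := C_AbsRing) (V := C_NormedModule) (fun l => c l * on_circle r t ^ l)%C s /\
     Cmod s <= K) ->
  r ^ N * Cmod (Csum (fun i => Csum (fun i' => x i * x i' * hankel c N (i + i')) N) N)%C
  <= K * sum_f_R0 (fun i => Cmod (x i) ^ 2) N.
Proof.
intros Hr [S HS] HK.
set (B := sum_f_R0 (fun i => Cmod (x i) ^ 2) N).
assert (HB : 0 <= B) by (apply cond_pos_sum; intros; apply pow2_ge_0).
apply le_epsilon; intros eps Heps.
(* The divisor is B + 1 because B may be 0. *)
assert (Heps' : 0 < eps / (B + 1)) by (apply Rdiv_lt_0_compat; lra).
assert (HS' := HS). apply is_series_Reals in HS'.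
destruct (HS' _ Heps') as [n0 Hn0].
apply Rle_trans with ((K + eps / (B + 1)) * B).
- apply hankel_form_polynomial with (L := (N + n0)%nat); [assumption|lia|].
  intros t. destruct (HK t) as [s [Hs HsK]].
  assert (Htail := is_series_tail_le _ s S (N + n0) Hs).
  assert (E : forall l, Cmod (c l * on_circle r t ^ l)%C = Cmod (c l) * r ^ l).
  { intros l. now rewrite Cmod_mult, Cmod_pow, Cmod_on_circle by lra. }
  rewrite (sum_eq _ _ _ (fun i _ => E i)) in Htail.
  assert (Ht : Cmod (Csum (fun l => c l * on_circle r t ^ l) (N + n0) - s)%C <= eps / (B + 1)).
  { eapply Rle_trans.
    - apply Htail. apply is_series_ext with (2 := HS). intros; now rewrite E.
    - specialize (Hn0 (N + n0)%nat ltac:(lia)). unfold Rdist in Hn0.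
      apply Rabs_def2 in Hn0. lra. }
  replace (Csum (fun l => c l * on_circle r t ^ l)%C (N + n0)) with
    ((Csum (fun l => c l * on_circle r t ^ l) (N + n0) - s) + s)%C by ring.
  eapply Rle_trans; [apply Cmod_triangle|]. lra.
- assert (eps / (B + 1) * B <= eps); [|lra].
  apply Rmult_le_reg_r with (B + 1); [lra|].
  replace (eps / (B + 1) * B * (B + 1)) with (eps * B) by (field; lra). nra.
Qed.

(** The limit r -> 1 made explicit: Bernoulli's inequality at r = 1 - e gives A <= B + n e A, and e
    is chosen with e (n A + 1) <= eps. The cap 1 / 2 keeps r inside (0, 1). *)
Lemma le_of_pow_mult_le (n : nat) (A B : R) :
  0 <= A -> (forall r, 0 < r < 1 -> r ^ n * A <= B) -> A <= B.
Proof.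
intros HA H. apply le_epsilon; intros eps Heps.
set (e := Rmin (1 / 2) (eps / (INR n * A + 1))).
assert (Hn := pos_INR n).
assert (HnA : 0 <= INR n * A) by now apply Rmult_le_pos.
assert (He : 0 < e <= 1 / 2).
{ unfold e; split; [apply Rmin_glb_lt; [lra|apply Rdiv_lt_0_compat; lra]|apply Rmin_l]. }
assert (He2 : e * (INR n * A + 1) <= eps).
{ apply Rle_trans with (eps / (INR n * A + 1) * (INR n * A + 1)).
  - apply Rmult_le_compat_r; [lra|apply Rmin_r].
  - right; field; lra. }
clearbody e.
assert (Hb : 1 - INR n * e <= (1 - e) ^ n).
{ clear - He. induction n as [|n IH]; [simpl; lra|].
  rewrite S_INR. simpl pow. assert (Hn := pos_INR n).
  apply Rle_trans with ((1 - e) * (1 - INR n * e)); [nra|].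
  apply Rmult_le_compat_l; lra. }
assert (H1 := H (1 - e) ltac:(lra)).
assert (H2 : (1 - INR n * e) * A <= (1 - e) ^ n * A) by now apply Rmult_le_compat_r.
nra.
Qed.

Lemma pow_lt_mono (x y : R) (n : nat) : 0 <= x < y -> (1 <= n)%nat -> x ^ n < y ^ n.
Proof.
intros Hxy Hn. destruct n as [|n]; [lia|clear Hn].
induction n as [|n IH]; [simpl; lra|].
assert (H : 0 <= x ^ S n) by (apply pow_le; lra).
change (x * x ^ S n < y * y ^ S n). nra.
Qed.

(** Neither factor [x] is conjugated, since the form is a coefficient of phi * X^2 and not an inner
    product. *)
Definition hankel_contractive (c : nat -> C) : Prop :=
  forall (x : nat -> C) N,
  Cmod (Csum (fun i => Csum (fun i' => x i * x i' * hankel c N (i + i')) N) N)%C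
  <= sum_f_R0 (fun i => Cmod (x i) ^ 2) N.

(* A function bounded by 1 in the disc acts on H^2 as a contraction.  The circle
   of radius [rho ^ p] is the image of the circle of radius [rho] under
   [z -> z ^ p], and the weight [rho ^ J] accounts for the factor [z ^ J] of [h];
   both disappear as [rho] tends to 1. *)
Lemma hankel_contraction (c : nat -> C) (p J : nat) :
  (1 <= p)%nat ->
  (forall rho t, 0 < rho < 1 -> exists s,
     is_series (K := C_AbsRing) (V := C_NormedModule)
       (fun l => c l * on_circle (rho ^ p) t ^ l)%C s /\
     rho ^ J * Cmod s <= 1) ->
  hankel_contractive c.
Proof.
intros Hp H x N.
apply (le_of_pow_mult_le (J + p * N)); [apply Cmod_ge_0|].
intros rho Hrho.
assert (HJ : 0 < rho ^ J) by (apply pow_lt; lra).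
rewrite pow_add, pow_mult, Rmult_assoc.
apply Rmult_le_reg_l with (/ rho ^ J); [now apply Rinv_0_lt_compat|].
rewrite <- Rmult_assoc, Rinv_l, Rmult_1_l by lra.
apply hankel_form_circle.
- split; [apply pow_le; lra|]. rewrite <- (pow1 p). apply pow_incr; lra.
(* Absolute convergence at radius [rho ^ p] comes from convergence at one point of larger modulus,
   here on the positive axis. *)
- destruct (H ((1 + rho) / 2) 0 ltac:(lra)) as [s [Hs _]].
  apply (abs_convergence_inside c (rho ^ p) (((1 + rho) / 2) ^ p) s).
  + split; [apply pow_le; lra|]. apply pow_lt_mono; [lra|lia].
  + apply is_series_ext with (2 := Hs). intros l. unfold on_circle.
    now rewrite cis_0, Cmult_1_r.
- intros t. destruct (H rho t Hrho) as [s [Hs1 Hs2]]. exists s. split; [assumption|].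
  apply Rmult_le_reg_l with (rho ^ J); [assumption|]. rewrite Rinv_r by lra. assumption.
Qed.

(** * Carlson's inequalities *)

Lemma Csum_S_l u n : Csum u (S n) = (u 0%nat + Csum (fun i => u (S i)) n)%C.
Proof.
induction n as [|n IH].
- now rewrite Csum_S, !Csum_O.
- rewrite Csum_S, IH, Csum_S. ring.
Qed.

Lemma Csum_rev u n : Csum u n = Csum (fun i => u (n - i)%nat) n.
Proof.
revert u; induction n as [|n IH]; intros u.
- now rewrite !Csum_O.
- rewrite Csum_S_l, IH, Csum_S, Nat.sub_diag, Cplus_comm. f_equal.
  apply Csum_ext; intros i Hi. f_equal; lia.
Qed.

Lemma Csum_truncate u m n :
  (m <= n)%nat -> (forall i, (m < i <= n)%nat -> u i = RtoC 0) -> Csum u n = Csum u m.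
Proof.
induction n as [|n IH]; intros Hm Hu.
- now replace m with 0%nat by lia.
- destruct (Nat.eq_dec m (S n)) as [->|Hn]; [reflexivity|].
  rewrite Csum_S, IH, Hu by (try lia; intros; apply Hu; lia). ring.
Qed.

(** The entries are parameters because the terms of the norm, the rows of the form and the terms of
    one row all have this shape again, so [Csum_test_vector] evaluates them all. *)
Definition test_vector (A B : C) (v : nat -> C) (n N j : nat) : C :=
  if Nat.eqb j 0 then A else if Nat.eqb j n then B
  else if Nat.ltb n j then v (N - j)%nat else RtoC 0.

(** For n = 0 the indices 0 and n coincide and A takes precedence; B must then be 0 for the formula
    to hold. *)
Lemma Csum_test_vector A B v n N :
  (n < N)%nat -> (n = 0%nat -> B = RtoC 0) ->
  Csum (test_vector A B v n N) N = (A + B + Csum v (N - n - 1))%C.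
Proof.
intros Hn HB.
rewrite (Csum_ext _ (fun j => (if Nat.eqb j 0 then A else 0) +
  (if Nat.eqb j n then B else 0) + (if Nat.ltb n j then v (N - j)%nat else 0))%C).
2: { intros j Hj. unfold test_vector.
     destruct (Nat.eqb_spec j 0), (Nat.eqb_spec j n), (Nat.ltb_spec n j);
       try lia; try ring. rewrite HB by lia. ring. }
rewrite !Csum_plus. f_equal; [f_equal|].
- rewrite (Csum_single _ N 0); [reflexivity|lia|].
  intros i _ Hi. destruct (Nat.eqb_spec i 0); [lia|reflexivity].
- rewrite (Csum_single _ N n); [now rewrite Nat.eqb_refl|lia|].
  intros i _ Hi. destruct (Nat.eqb_spec i n); [lia|reflexivity].
- rewrite Csum_rev, (Csum_truncate _ (N - n - 1)).
  + apply Csum_ext; intros i Hi. destruct (Nat.ltb_spec n (N - i)); [|lia]. f_equal; lia.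
  + lia.
  + intros i Hi. destruct (Nat.ltb_spec n (N - i)); [lia|reflexivity].
Qed.

Definition sqmod_sum (c : nat -> C) (n : nat) : R := sum_f_R0 (fun i => Cmod (c i) ^ 2) n.

(* The test vector is [1] at index [0], [xi] at the middle index [n], and the
   conjugate of [c (N - j)] at [j > n]. *)
Lemma hankel_test_vector (c : nat -> C) (n N : nat) (xi : C) :
  hankel_contractive c ->
  (N = 2 * n /\ 1 <= n)%nat \/ N = (2 * n + 1)%nat /\ xi = RtoC 0 ->
  Cmod (c N + 2 * xi * c (N - n)%nat + xi * xi * c 0%nat +
        2 * sqmod_sum c (N - n - 1))%C
  <= 1 + Cmod xi ^ 2 + sqmod_sum c (N - n - 1).
Proof.
intros Hc HN.
assert (HnN : (n < N)%nat) by lia.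
set (x := test_vector 1 xi (fun j => Cconj (c j)) n N).
set (S := sqmod_sum c (N - n - 1)).
assert (HS : Csum (fun j => RtoC (Cmod (c j) ^ 2)) (N - n - 1) = RtoC S)
  by apply Csum_RtoC.
assert (Hxi : n = 0%nat -> xi = RtoC 0) by (destruct HN as [HN|[_ ->]]; [lia|auto]).
replace (c N + 2 * xi * c (N - n)%nat + xi * xi * c 0%nat + 2 * S)%C with
  (Csum (fun i => Csum (fun i' => x i * x i' * hankel c N (i + i')) N) N)%C.
- eapply Rle_trans; [apply Hc|]. right. apply RtoC_inj.
  rewrite <- Csum_RtoC, !RtoC_plus, <- HS.
  rewrite <- (Csum_test_vector _ _ (fun j => RtoC (Cmod (c j) ^ 2)) n N HnN).
  2: { intros Hn. rewrite Hxi, Cmod_0 by assumption. f_equal; ring. }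
  apply Csum_ext; intros j Hj. unfold x, test_vector.
  destruct (Nat.eqb_spec j 0), (Nat.eqb_spec j n), (Nat.ltb_spec n j);
    rewrite ?Cmod_conj, ?Cmod_1, ?Cmod_0; try reflexivity; f_equal; ring.
(* Row by row: row 0 meets every column. Row n meets only columns 0 and n, since n + j > N for j >
   n, and it vanishes when xi = 0. A row i > n meets only column 0 and gives |c (N - i)|^2. *)
- transitivity (Csum (test_vector (c N + xi * c (N - n)%nat + S)
     (xi * (c (N - n)%nat + xi * c 0%nat)) (fun j => RtoC (Cmod (c j) ^ 2)) n N) N)%C.
  2: { rewrite Csum_test_vector, HS; [ring|assumption|].
       intros Hn. rewrite Hxi by assumption. ring. }
  apply Csum_ext; intros i Hi.
  transitivity (x i * Csum (fun i' => x i' * hankel c N (i + i')) N)%C.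
  { rewrite <- Csum_mult_l. apply Csum_ext; intros; ring. }
  unfold x at 1. unfold test_vector at 2.
  destruct (Nat.eqb_spec i 0) as [Hi0|Hi0];
    [subst i; unfold test_vector at 1; simpl (Nat.eqb 0 0)
    |unfold test_vector at 1; rewrite (proj2 (Nat.eqb_neq i 0) Hi0);
     destruct (Nat.eqb_spec i n) as [Hin|Hin]; [|destruct (Nat.ltb_spec n i) as [L|L]]].
  + rewrite Cmult_1_l, <- HS, <- Csum_test_vector
      by (try assumption; intros Hn; rewrite Hxi by assumption; ring).
    apply Csum_ext; intros j Hj. unfold hankel. rewrite Nat.add_0_l.
    rewrite (proj2 (Nat.leb_le j N) Hj). unfold x, test_vector.
    destruct (Nat.eqb_spec j 0) as [->|Hj0]; [rewrite Nat.sub_0_r; ring|].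
    destruct (Nat.eqb_spec j n) as [->|Hjn]; [reflexivity|].
    destruct (Nat.ltb_spec n j); [|ring]. rewrite Cmod2_conj. ring.
  + destruct HN as [[HN Hn]|[_ Hxi0]]; [|rewrite Hxi0; ring].
    f_equal. transitivity (Csum (test_vector (c (N - n)%nat) (xi * c 0%nat) (fun _ => RtoC 0) n N) N).
    * apply Csum_ext; intros j Hj. unfold hankel, x, test_vector. subst i.
      destruct (Nat.eqb_spec j 0) as [->|Hj0].
      { rewrite Nat.add_0_r, (proj2 (Nat.leb_le n N)) by lia. ring. }
      destruct (Nat.eqb_spec j n) as [->|Hjn].
      { rewrite (proj2 (Nat.leb_le (n + n) N)) by lia. do 2 f_equal. lia. }
      destruct (Nat.ltb_spec n j); [|ring].
      rewrite (proj2 (Nat.leb_gt (n + j) N)) by lia. ring.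
    * rewrite Csum_test_vector, Csum_zero; [ring|auto|assumption|lia].
  + rewrite (Csum_single _ N 0).
    * unfold hankel, x, test_vector. rewrite Nat.add_0_r, (proj2 (Nat.leb_le i N)) by lia.
      rewrite Cmod2_conj, Nat.eqb_refl. ring.
    * lia.
    * intros j Hj Hj0. unfold hankel, x, test_vector.
      rewrite (proj2 (Nat.eqb_neq j 0) Hj0).
      destruct (Nat.eqb_spec j n) as [->|Hjn].
      { destruct HN as [[HN Hn]|[_ Hxi0]]; [|rewrite Hxi0; ring].
        rewrite (proj2 (Nat.leb_gt (i + n) N)) by lia. ring. }
      destruct (Nat.ltb_spec n j); [|ring].
      rewrite (proj2 (Nat.leb_gt (i + j) N)) by lia. ring.
  + ring.
Qed.

(** Used to make one chosen coefficient real and nonnegative, so that it adds to the squares in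
    [hankel_test_vector] instead of cancelling against them. *)
Lemma hankel_contractive_rotate (c : nat -> C) (w : C) :
  Cmod w = 1 -> hankel_contractive c -> hankel_contractive (fun j => w * c j)%C.
Proof.
intros Hw Hc x N. specialize (Hc x N).
replace (Csum _ N) with
  (w * Csum (fun i => Csum (fun i' => x i * x i' * hankel c N (i + i')) N) N)%C.
- now rewrite Cmod_mult, Hw, Rmult_1_l.
- rewrite <- Csum_mult_l. apply Csum_ext; intros i _.
  rewrite <- Csum_mult_l. apply Csum_ext; intros i' _.
  unfold hankel. destruct (Nat.leb (i + i') N); ring.
Qed.

Lemma exists_rotation (z : C) : exists w, Cmod w = 1 /\ (w * z)%C = RtoC (Cmod z).
Proof.
destruct (Ceq_dec z (RtoC 0)) as [->|Hz].
- exists (RtoC 1). rewrite Cmod_1, Cmod_0. split; [reflexivity|ring].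
- assert (Hm := proj1 (Cmod_gt_0 z) Hz).
  assert (Hm' : RtoC (Cmod z) <> RtoC 0) by (intros H; apply RtoC_inj in H; lra).
  exists (Cconj z / Cmod z)%C. split.
  + rewrite Cmod_div, Cmod_conj, Cmod_R, Rabs_right by (try lra; assumption). field. lra.
  + transitivity (z * Cconj z / Cmod z)%C; [field; assumption|].
    rewrite <- Cmod2_conj, RtoC_pow. field. assumption.
Qed.

Lemma sqmod_sum_rotate (c : nat -> C) (w : C) n :
  Cmod w = 1 -> sqmod_sum (fun j => w * c j)%C n = sqmod_sum c n.
Proof.
intros Hw. apply sum_eq; intros i _. now rewrite Cmod_mult, Hw, Rmult_1_l.
Qed.

Lemma Re_le_Cmod (z : C) : Re z <= Cmod z.
Proof. eapply Rle_trans; [apply Rle_abs|apply re_le_Cmod]. Qed.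

Lemma carlson_odd (c : nat -> C) (n : nat) :
  hankel_contractive c -> Cmod (c (2 * n + 1)%nat) <= 1 - sqmod_sum c n.
Proof.
intros Hc. destruct (exists_rotation (c (2 * n + 1)%nat)) as [w [Hw Hwc]].
assert (H := hankel_test_vector _ n (2 * n + 1) (RtoC 0)
               (hankel_contractive_rotate c w Hw Hc) (or_intror (conj eq_refl eq_refl))).
cbv beta in H. rewrite Hwc, sqmod_sum_rotate in H by assumption.
replace (2 * n + 1 - n - 1)%nat with n in H by lia.
apply (Rle_trans _ _ _ (Re_le_Cmod _)) in H.
match type of H with Re ?e <= _ =>
  replace e with (RtoC (Cmod (c (2 * n + 1)%nat) + 2 * sqmod_sum c n)) in H
    by (rewrite RtoC_plus, RtoC_mult; ring) end.
rewrite Cmod_0 in H. unfold Re, RtoC, fst in H. lra.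
Qed.

Lemma carlson_even (c : nat -> C) (n : nat) :
  hankel_contractive c ->
  Cmod (c (2 * S n)%nat) <=
  1 - sqmod_sum c n - Cmod (c (S n)) ^ 2 / (1 + Cmod (c 0%nat)).
Proof.
intros Hc. destruct (exists_rotation (c (2 * S n)%nat)) as [w [Hw Hwc]].
(* With xi = t * conj a and d = |c (n + 1)|^2 the gain is at least 2 t d - t^2 d (1 + |c 0|), the
   subtracted part covering |xi|^2 and the worst case of xi^2 c 0. This t maximises it, with value d
   / (1 + |c 0|). *)
set (t := / (1 + Cmod (c 0%nat))).
assert (H0 := Cmod_ge_0 (c 0%nat)).
assert (Ht : 0 < t) by (apply Rinv_0_lt_compat; lra).
set (a := (w * c (S n))%C).
assert (H := hankel_test_vector _ (S n) (2 * S n) (t * Cconj a)%C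
               (hankel_contractive_rotate c w Hw Hc)
               (or_introl (conj eq_refl (le_n_S _ _ (Nat.le_0_l n))))).
cbv beta in H. rewrite Hwc, sqmod_sum_rotate in H by assumption.
replace (2 * S n - S n - 1)%nat with n in H by lia.
replace (2 * S n - S n)%nat with (S n) in H by lia. fold a in H.
assert (Ha : Cmod a = Cmod (c (S n))) by (unfold a; rewrite Cmod_mult, Hw; ring).
rewrite Cmod_mult, Cmod_conj, Cmod_R, Rabs_right, Ha in H by lra.
set (d := Cmod (c (S n)) ^ 2) in *.
set (e := (t * Cconj a * (t * Cconj a) * (w * c 0%nat))%C) in H.
assert (He : Cmod e = t ^ 2 * d * Cmod (c 0%nat)).
{ unfold e, d. rewrite !Cmod_mult, Cmod_conj, Cmod_R, Rabs_right, Ha, Hw by lra. ring. }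
assert (H1 := Rle_trans _ _ _ (Re_le_Cmod _) H).
(* The phase of e is not controlled; [H2] is - Re e <= |e|. *)
assert (H2 := Rle_trans _ _ _ (Rle_abs _) (Rle_trans _ _ _
                (Req_le _ _ (Rabs_Ropp (Re e))) (re_le_Cmod e))).
match type of H1 with Re ?e1 <= _ =>
  replace e1 with (RtoC (Cmod (c (2 * S n)%nat) + 2 * t * d + 2 * sqmod_sum c n) + e)%C in H1
end.
2: { unfold d. rewrite <- Ha, !RtoC_plus, !RtoC_mult, Cmod2_conj. ring. }
change (Cmod (c (2 * S n)%nat) + 2 * t * d + 2 * sqmod_sum c n + Re e <=
        1 + (t * Cmod (c (S n))) ^ 2 + sqmod_sum c n) in H1.
rewrite He in H2. rewrite Rpow_mult_distr in H1. fold d in H1.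
unfold Rdiv. fold t.
assert (Ht1 : t * (1 + Cmod (c 0%nat)) = 1) by (unfold t; field; lra).
replace (t ^ 2 * d * Cmod (c 0%nat)) with (t * d * (t * (1 + Cmod (c 0%nat))) - t ^ 2 * d) in H2
  by ring.
rewrite Ht1 in H2. lra.
Qed.

(** * The refined Bohr inequality *)

Lemma sqmod_sum_le_1 (c : nat -> C) n : hankel_contractive c -> sqmod_sum c n <= 1.
Proof.
intros Hc. assert (H := carlson_odd c n Hc).
assert (H0 := Cmod_ge_0 (c (2 * n + 1)%nat)). lra.
Qed.

Lemma coeff_le_1 (c : nat -> C) n : hankel_contractive c -> Cmod (c n) <= 1.
Proof.
intros Hc. assert (H := sqmod_sum_le_1 c n Hc).
assert (H1 := term_le_sum (fun i => Cmod (c i) ^ 2) n n (fun i => pow2_ge_0 _) (le_n n)).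
fold (sqmod_sum c n) in H1. cbv beta in H1.
assert (H0 := Cmod_ge_0 (c n)). nra.
Qed.

Definition bohr_weight (c : nat -> C) (x : R) : R :=
  1 / (1 + Cmod (c 0%nat)) + x / (1 - x).

(* Carlson's inequalities, added up two by two; the last term is the remainder of
   the geometric series, with the defect [1 - sqmod_sum c N]. *)
Lemma bohr_partial (c : nat -> C) (x : R) (N : nat) :
  hankel_contractive c -> 0 <= x < 1 ->
  sum_f_R0 (fun j => Cmod (c j) * x ^ j) (2 * N) +
  bohr_weight c x * sum_f_R0 (fun j => Cmod (c j) ^ 2 * x ^ (2 * j)) N <=
  Cmod (c 0%nat) + (1 - Cmod (c 0%nat) ^ 2) * (x / (1 - x)) +
  bohr_weight c x * Cmod (c 0%nat) ^ 2 -
  (1 - sqmod_sum c N) * (x ^ (2 * N + 1) / (1 - x)).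
Proof.
intros Hc Hx. induction N as [|N IH].
- unfold sqmod_sum. simpl. right. field. lra.
- replace (2 * S N)%nat with (S (S (2 * N))) by lia.
  rewrite !tech5. unfold sqmod_sum. rewrite tech5. fold (sqmod_sum c N).
  assert (Ho := carlson_odd c N Hc). assert (He := carlson_even c N Hc).
  replace (2 * N + 1)%nat with (S (2 * N)) in * by lia.
  replace (2 * S N)%nat with (S (S (2 * N))) in * by lia.
  replace (S (S (2 * N)) + 1)%nat with (S (S (S (2 * N)))) by lia.
  set (A := sqmod_sum c N) in *. set (d := Cmod (c (S N)) ^ 2) in *.
  cbv beta. rewrite <- !(tech_pow_Rmult x) in *.
  set (y := x ^ (2 * N)) in *.
  assert (Hy : 0 <= y) by (apply pow_le; lra).
  set (a := Cmod (c 0%nat)) in *. assert (Ha : 0 <= a) by apply Cmod_ge_0.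
  assert (H1 : Cmod (c (S (2 * N))) * (x * y) <= (1 - A) * (x * y))
    by (apply Rmult_le_compat_r; [nra|assumption]).
  assert (H2 : Cmod (c (S (S (2 * N)))) * (x * (x * y)) <= (1 - A - d / (1 + a)) * (x * (x * y)))
    by (apply Rmult_le_compat_r; [apply Rmult_le_pos; nra|assumption]).
  (* The telescoping identity. The part 1 / (1 + a) of the weight compensates the d / (1 + a) lost
     in the even inequality; the part x / (1 - x) accounts for the defect shrinking from 1 - A to 1
     - A - d. *)
  assert (E : (1 - A) * (x * y / (1 - x)) - (1 - (A + d)) * (x * (x * (x * y)) / (1 - x)) =
    (1 - A) * (x * y) + (1 - A - d / (1 + a)) * (x * (x * y)) +
    bohr_weight c x * (d * (x * (x * y)))).
  { unfold bohr_weight. fold a. field. lra. }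
  lra.
Qed.

Lemma ex_series_coeff (c : nat -> C) (x : R) :
  hankel_contractive c -> 0 <= x < 1 -> ex_series (fun j => Cmod (c j) * x ^ j).
Proof.
intros Hc Hx.
apply (ex_series_le (K := R_AbsRing) (V := R_CompleteNormedModule)) with (b := fun j => x ^ j).
- intros j. change (Rabs (Cmod (c j) * x ^ j) <= x ^ j).
  assert (Hj : 0 <= x ^ j) by (apply pow_le; lra).
  assert (H0 := Cmod_ge_0 (c j)). assert (H1 := coeff_le_1 c j Hc).
  rewrite Rabs_right by nra. nra.
- apply ex_series_geom. rewrite Rabs_right; lra.
Qed.

Lemma ex_series_coeff_sq (c : nat -> C) (x : R) :
  hankel_contractive c -> 0 <= x < 1 -> ex_series (fun j => Cmod (c j) ^ 2 * x ^ (2 * j)).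
Proof.
intros Hc Hx.
apply (ex_series_le (K := R_AbsRing) (V := R_CompleteNormedModule)) with (b := fun j => x ^ j).
- intros j. change (Rabs (Cmod (c j) ^ 2 * x ^ (2 * j)) <= x ^ j).
  replace (2 * j)%nat with (j + j)%nat by lia. rewrite pow_add.
  assert (Hj : 0 <= x ^ j <= 1).
  { split; [apply pow_le; lra|]. rewrite <- (pow1 j). apply pow_incr; lra. }
  assert (H0 := Cmod_ge_0 (c j)). assert (H1 := coeff_le_1 c j Hc).
  assert (H2 : 0 <= Cmod (c j) ^ 2 <= 1) by nra.
  assert (H3 : 0 <= x ^ j * x ^ j <= x ^ j) by nra.
  rewrite Rabs_right by nra. nra.
- apply ex_series_geom. rewrite Rabs_right; lra.
Qed.

(** Limit of [bohr_partial], whose remainder term is nonnegative because [sqmod_sum c N <= 1]. *)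
Lemma bohr_refined (c : nat -> C) (x : R) :
  hankel_contractive c -> 0 <= x < 1 ->
  Series (fun j => Cmod (c j) * x ^ j) +
  bohr_weight c x * Series (fun j => Cmod (c (S j)) ^ 2 * x ^ (2 * S j)) <=
  Cmod (c 0%nat) + (1 - Cmod (c 0%nat) ^ 2) * (x / (1 - x)).
Proof.
intros Hc Hx.
assert (Hs := ex_series_coeff c x Hc Hx).
assert (Hq := ex_series_coeff_sq c x Hc Hx).
(* Splits off the square of index 0, which [bohr_partial] carries on both sides so that its base
   case is an equality. *)
assert (E := Series_incr_1 _ Hq). cbv beta in E.
assert (H : is_lim_seq (fun N => sum_f_R0 (fun j => Cmod (c j) * x ^ j) (2 * N) +
    bohr_weight c x * sum_f_R0 (fun j => Cmod (c j) ^ 2 * x ^ (2 * j)) N)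
  (Series (fun j => Cmod (c j) * x ^ j) +
   bohr_weight c x * Series (fun j => Cmod (c j) ^ 2 * x ^ (2 * j)))).
{ apply is_lim_seq_plus'.
  - apply is_lim_seq_ext with (fun N => sum_n (fun j => Cmod (c j) * x ^ j) (2 * N));
      [intros; apply sum_n_Reals|].
    apply (is_lim_seq_subseq (sum_n (fun j => Cmod (c j) * x ^ j)) _ (fun N => (2 * N)%nat)).
    + apply eventually_subseq. intros; lia.
    + exact (Series_correct _ Hs).
  - apply (is_lim_seq_scal_l _ _ (Finite _)).
    apply is_lim_seq_ext with (sum_n (fun j => Cmod (c j) ^ 2 * x ^ (2 * j)));
      [intros; apply sum_n_Reals|].
    exact (Series_correct _ Hq). }
set (B := Cmod (c 0%nat) + (1 - Cmod (c 0%nat) ^ 2) * (x / (1 - x)) +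
  bohr_weight c x * Cmod (c 0%nat) ^ 2).
assert (HB : forall N, sum_f_R0 (fun j => Cmod (c j) * x ^ j) (2 * N) +
    bohr_weight c x * sum_f_R0 (fun j => Cmod (c j) ^ 2 * x ^ (2 * j)) N <= B).
{ intros N. eapply Rle_trans; [apply (bohr_partial c x N Hc Hx)|].
  assert (HA := sqmod_sum_le_1 c N Hc).
  assert (0 <= (1 - sqmod_sum c N) * (x ^ (2 * N + 1) / (1 - x))); [|unfold B; lra].
  apply Rmult_le_pos; [lra|]. apply Rdiv_le_0_compat; [apply pow_le|]; lra. }
assert (Hle := is_lim_seq_le _ _ _ _ HB H (is_lim_seq_const B)).
unfold Rbar_le, B in Hle. rewrite E, Nat.mul_0_r, pow_O, Rmult_1_r in Hle.
rewrite Rmult_plus_distr_l in Hle. lra.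
Qed.

Lemma expansion_contractive (k m p : nat) (a : nat -> C) (h : C -> C) :
  (1 <= p)%nat -> has_expansion k m p a h -> class_B h ->
  hankel_contractive (fun j => a (p * (k + j) + m)%nat).
Proof.
intros Hp Hexp [_ HB].
apply (hankel_contraction _ p (p * k + m) Hp).
intros rho t Hrho.
(* A p-th root of the point at radius [rho ^ p] and angle t. There the series of phi is that of h
   divided by z^J. *)
set (z := on_circle rho (t / INR p)).
assert (HzR : Cmod z = rho) by (apply Cmod_on_circle; lra).
assert (Hz : in_disc z) by (unfold in_disc; lra).
assert (Hz0 : z <> RtoC 0) by (apply Cmod_gt_0; lra).
assert (HzJ := Cpow_nz z (p * k + m) Hz0).
assert (HpR : INR p <> 0) by (apply not_0_INR; lia).
assert (Hw : on_circle (rho ^ p) t = (z ^ p)%C).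
{ unfold z. rewrite on_circle_pow. unfold on_circle. do 2 f_equal. now field. }
exists (/ z ^ (p * k + m) * h z)%C. split.
- apply (is_series_ext (fun j => scal (/ z ^ (p * k + m))%C
     (a (p * (k + j) + m)%nat * z ^ (p * (k + j) + m))%C)).
  + intros j. rewrite Hw, <- Cpow_mult_r.
    replace (z ^ (p * (k + j) + m))%C with (z ^ (p * k + m) * z ^ (p * j))%C
      by (rewrite <- Cpow_add_r; f_equal; lia).
    change (/ z ^ (p * k + m) * (a (p * (k + j) + m)%nat * (z ^ (p * k + m) * z ^ (p * j))) =
            a (p * (k + j) + m)%nat * z ^ (p * j))%C.
    now field.
  + apply (is_series_scal_l (K := C_AbsRing) (V := C_NormedModule)). now apply Hexp.
- rewrite Cmod_mult, Cmod_inv, Cmod_pow, HzR by assumption.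
  assert (HJ : 0 < rho ^ (p * k + m)) by (apply pow_lt; lra).
  rewrite <- Rmult_assoc, Rinv_r, Rmult_1_l by lra. now apply HB.
Qed.

(** The power r^J leaves the second sum too, because 2 n - k = k + 2 (n - k). *)
Lemma M1_factor (k m p : nat) (a : nat -> C) (r : R) :
  let c := fun j => a (p * (k + j) + m)%nat in
  M1 k m p a r = r ^ (p * k + m) *
    (Series (fun j => Cmod (c j) * (r ^ p) ^ j) +
     bohr_weight c (r ^ p) * Series (fun j => Cmod (c (S j)) ^ 2 * (r ^ p) ^ (2 * S j))).
Proof.
intros c. unfold M1, bohr_weight, series_from, c.
rewrite Nat.add_0_r, Rmult_plus_distr_l. f_equal.
- rewrite <- Series_scal_l. apply Series_ext; intros j. rewrite <- pow_mult.
  replace (p * (k + j) + m)%nat with (p * k + m + p * j)%nat at 2 by lia.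
  rewrite pow_add. ring.
- rewrite <- Rmult_assoc, (Rmult_comm (r ^ _)), Rmult_assoc. f_equal.
  rewrite <- Series_scal_l. apply Series_ext; intros j. rewrite <- pow_mult.
  replace (k + 1 + j)%nat with (k + S j)%nat by lia.
  replace (p * (2 * (k + S j) - k) + m)%nat with (p * k + m + p * (2 * S j))%nat.
  + rewrite pow_add. ring.
  + replace (2 * (k + S j) - k)%nat with (k + 2 * S j)%nat by lia. lia.
Qed.

Lemma bohr_bound_AMGM (a x : R) :
  0 < x < 1 -> a + (1 - a ^ 2) * (x / (1 - x)) <= (5 * x ^ 2 - 2 * x + 1) / (4 * x * (1 - x)).
Proof.
intros Hx.
assert (E : (5 * x ^ 2 - 2 * x + 1) / (4 * x * (1 - x)) - (a + (1 - a ^ 2) * (x / (1 - x))) =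
  (x / (1 - x)) * (a - (1 - x) / (2 * x)) ^ 2) by (field; lra).
assert (0 <= (x / (1 - x)) * (a - (1 - x) / (2 * x)) ^ 2); [|lra].
apply Rmult_le_pos; [|apply pow2_ge_0]. apply Rlt_le, Rdiv_lt_0_compat; lra.
Qed.

(** * The equation of tau_k *)

Definition tau_fun (k m p : nat) (t : R) : R :=
  2 * (1 - t ^ p) - t ^ (p * (k - 1) + m) * (5 * t ^ (2 * p) - 2 * t ^ p + 1).

(** With x = t^p, the factor 5 x^2 - 2 x + 1 is not monotone on (0, 1). Since k >= 2, one factor x
    can be borrowed from the power of t, and 5 x^3 - 2 x^2 + x is increasing: its derivative 15 x^2
    - 4 x + 1 has negative discriminant. *)
Lemma tau_fun_decreasing (k m p : nat) (s t : R) :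
  (2 <= k)%nat -> (1 <= p)%nat -> 0 <= s < t -> t <= 1 -> tau_fun k m p t < tau_fun k m p s.
Proof.
intros Hk Hp Hst Ht.
assert (E : forall u, tau_fun k m p u =
  2 * (1 - u ^ p) - u ^ (p * (k - 2) + m) * (5 * (u ^ p) ^ 3 - 2 * (u ^ p) ^ 2 + u ^ p)).
{ intros u. unfold tau_fun.
  replace (p * (k - 1) + m)%nat with (p * (k - 2) + m + p)%nat.
  - rewrite pow_add, (Nat.mul_comm 2 p), pow_mult. ring.
  - replace (k - 1)%nat with (k - 2 + 1)%nat by lia. lia. }
rewrite !E.
assert (H1 := pow_lt_mono s t p Hst Hp).
assert (H2 : 0 <= s ^ p) by (apply pow_le; lra).
assert (H3 : s ^ (p * (k - 2) + m) <= t ^ (p * (k - 2) + m)) by (apply pow_incr; lra).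
assert (H4 : 0 <= s ^ (p * (k - 2) + m)) by (apply pow_le; lra).
set (x := s ^ p) in *. set (y := t ^ p) in *.
assert (H5 : 0 <= 5 * x ^ 3 - 2 * x ^ 2 + x).
{ replace (5 * x ^ 3 - 2 * x ^ 2 + x) with (x * (4 * x ^ 2 + (1 - x) ^ 2)) by ring.
  apply Rmult_le_pos; [assumption|nra]. }
assert (H6 : 5 * x ^ 3 - 2 * x ^ 2 + x <= 5 * y ^ 3 - 2 * y ^ 2 + y).
{ replace (5 * y ^ 3 - 2 * y ^ 2 + y) with (5 * x ^ 3 - 2 * x ^ 2 + x +
    (y - x) * (5 * (y ^ 2 + y * x + x ^ 2) - 2 * (x + y) + 1)) by ring.
  assert (H6 : 0 <= 5 * (y ^ 2 + y * x + x ^ 2) - 2 * (x + y) + 1).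
  (* The divided difference of the cubic as a sum of squares, from x^2 + x y + y^2 = 3/4 (x + y)^2 +
     1/4 (x - y)^2. *)
  { replace (5 * (y ^ 2 + y * x + x ^ 2) - 2 * (x + y) + 1) with
      ((x + y - 1) ^ 2 + 11 / 4 * (x + y) ^ 2 + 5 / 4 * (x - y) ^ 2) by field.
    assert (Q1 := pow2_ge_0 (x + y - 1)). assert (Q2 := pow2_ge_0 (x + y)).
    assert (Q3 := pow2_ge_0 (x - y)). lra. }
  assert (H8 := Rmult_le_pos (y - x) _ ltac:(lra) H6). lra. }
assert (H7 := Rmult_le_compat _ _ _ _ H4 H5 H3 H6). lra.
Qed.

Lemma tau_exists (k m p : nat) :
  (1 <= p)%nat -> (1 <= m)%nat -> exists t, is_root_tau k m p t.
Proof.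
intros Hp Hm.
(* [IVT] expects a change from negative to positive, whereas [tau_fun] is 2 at 0 and -4 at 1. *)
assert (H0 : - tau_fun k m p 0 < 0).
{ unfold tau_fun. rewrite (pow_i p), (pow_i (p * (k - 1) + m)), (pow_i (2 * p)) by nia. lra. }
assert (H1 : 0 < - tau_fun k m p 1).
{ unfold tau_fun. rewrite !pow1. lra. }
destruct (IVT (fun t => - tau_fun k m p t) 0 1) as [t [Ht Hroot]];
  [unfold tau_fun; reg|lra|assumption|assumption|].
exists t. split.
- split; apply Rnot_le_lt; intros H.
  + replace t with 0 in Hroot by lra. lra.
  + replace t with 1 in Hroot by lra. lra.
- unfold tau_fun in Hroot. lra.
Qed.

Lemma bohr_upto_tau (k m p : nat) (tau : R) :
  (2 <= k)%nat -> (1 <= m)%nat -> (1 <= p)%nat -> is_root_tau k m p tau ->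
  bohr_inequality_upto k m p tau.
Proof.
intros Hk Hm Hp [Htau Hroot] a b f h g (_ & _ & Ha & Hb & [Hh _] & [Hg _]) r Hr.
assert (HF : 0 <= tau_fun k m p r).
{ destruct (Req_dec r tau) as [->|Hn]; [unfold tau_fun; lra|].
  assert (H := tau_fun_decreasing k m p r tau Hk Hp ltac:(lra) ltac:(lra)).
  unfold tau_fun in *. lra. }
assert (Hx : 0 <= r ^ p < 1) by (apply pow_lt_1_compat; [lra|lia]).
assert (HJ : 0 <= r ^ (p * k + m)) by (apply pow_le; lra).
rewrite !M1_factor.
assert (Ba := bohr_refined _ _ (expansion_contractive k m p a h Hp Ha Hh) Hx).
assert (Bb := bohr_refined _ _ (expansion_contractive k m p b g Hp Hb Hg) Hx).
cbv beta in Ba, Bb |- *.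
(* [bohr_bound_AMGM] divides by x = r^p; at r = 0 the factor r^J already makes both sums vanish. *)
destruct (Req_dec r 0) as [->|Hr0].
- rewrite (pow_i (p * k + m)) by nia. lra.
- assert (Hx' : 0 < r ^ p < 1) by (split; [apply pow_lt|]; lra).
  assert (Ca := Rle_trans _ _ _ Ba (bohr_bound_AMGM _ _ Hx')).
  assert (Cb := Rle_trans _ _ _ Bb (bohr_bound_AMGM _ _ Hx')).
  apply (Rmult_le_compat_l _ _ _ HJ) in Ca. apply (Rmult_le_compat_l _ _ _ HJ) in Cb.
  eapply Rle_trans; [apply (Rplus_le_compat _ _ _ _ Ca Cb)|].
  unfold tau_fun in HF. rewrite (Nat.mul_comm 2 p), pow_mult in HF.
  replace (p * k + m)%nat with (p + (p * (k - 1) + m))%nat.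
  2: { destruct k; [lia|]. simpl Nat.sub. rewrite Nat.sub_0_r. lia. }
  rewrite pow_add. set (x := r ^ p) in *. set (y := r ^ (p * (k - 1) + m)) in *.
  apply Rmult_le_reg_r with (2 * (1 - x)); [lra|].
  replace ((x * y * ((5 * x ^ 2 - 2 * x + 1) / (4 * x * (1 - x))) +
    x * y * ((5 * x ^ 2 - 2 * x + 1) / (4 * x * (1 - x)))) * (2 * (1 - x)))
    with (y * (5 * x ^ 2 - 2 * x + 1)) by (field; lra).
  lra.
Qed.

(** * Smooth complex functions and harmonicity *)

Notation is_Cderive := (is_derive (K := C_AbsRing) (V := C_NormedModule)).

Lemma is_Cderive_iff (h : C -> C) (z l : C) :
  is_Cderive h z l <->
  forall eps, 0 < eps -> exists delta, 0 < delta /\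
    forall w : C, Cmod (w - z)%C < delta ->
    Cmod (h w - h z - (w - z) * l)%C <= eps * Cmod (w - z)%C.
Proof.
split.
- intros [_ H] eps Heps.
  destruct (H z (fun P HP => HP) (mkposreal eps Heps)) as [d Hd].
  exists d. split; [apply cond_pos|]. intros w Hw. exact (Hd w Hw).
- intros H. split; [apply is_linear_scal_l|].
  intros x Hx eps.
  apply (is_filter_lim_locally_unique (V := AbsRing_NormedModule C_AbsRing)) in Hx. subst x.
  destruct (H eps (cond_pos eps)) as [d [Hd0 Hd]].
  exists (mkposreal d Hd0). intros w Hw. exact (Hd w Hw).
Qed.

(** Two normed module structures on [C] with the same norm: the rules for products, for the identity
    and for inner functions of compositions are about [AbsRing_NormedModule C_AbsRing]. *)
Lemma is_Cderive_AbsRing (h : C -> C) (z l : C) :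
  is_derive (K := C_AbsRing) (V := AbsRing_NormedModule C_AbsRing) h z l <->
  is_Cderive h z l.
Proof.
split; intros [[a b [M c]] H]; (split; [split; try assumption; exists M; exact c|exact H]).
Qed.

Lemma is_Cderive_mult (f g : C -> C) (z df dg : C) :
  is_Cderive f z df -> is_Cderive g z dg ->
  is_Cderive (fun x => f x * g x)%C z (df * g z + f z * dg)%C.
Proof.
rewrite <- !is_Cderive_AbsRing. intros Hf Hg.
exact (is_derive_mult (K := C_AbsRing) f g z df dg Hf Hg Cmult_comm).
Qed.

Lemma is_Cderive_plus (f g : C -> C) (z df dg : C) :
  is_Cderive f z df -> is_Cderive g z dg ->
  is_Cderive (fun x => f x + g x)%C z (df + dg)%C.
Proof. exact (is_derive_plus (K := C_AbsRing) (V := C_NormedModule) f g z df dg). Qed.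

Lemma is_Cderive_const (a z : C) : is_Cderive (fun _ => a) z (RtoC 0).
Proof. exact (is_derive_const (K := C_AbsRing) (V := C_NormedModule) a z). Qed.

Lemma is_Cderive_id (z : C) : is_Cderive (fun x => x) z (RtoC 1).
Proof. apply is_Cderive_AbsRing. exact (is_derive_id (K := C_AbsRing) z). Qed.

Lemma is_Cderive_pow (n : nat) (z : C) :
  is_Cderive (fun x => x ^ S n)%C z (INR (S n) * z ^ n)%C.
Proof.
induction n as [|n IH].
- apply (is_derive_ext (K := C_AbsRing) (V := C_NormedModule) (fun x : C => x)).
  + intros t. symmetry. apply Cpow_1_r.
  + simpl. rewrite Cmult_1_l. apply is_Cderive_id.
- replace (INR (S (S n)) * z ^ S n)%C with (1 * z ^ S n + z * (INR (S n) * z ^ n))%C.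
  + exact (is_Cderive_mult (fun x => x) (fun x => x ^ S n)%C z _ _ (is_Cderive_id z) IH).
  + rewrite (S_INR (S n)), RtoC_plus, Cpow_S. ring.
Qed.

Lemma is_Cderive_inv (z : C) : z <> RtoC 0 -> is_Cderive Cinv z (- (/ z * / z))%C.
Proof.
intros Hz. assert (Hm := proj1 (Cmod_gt_0 z) Hz).
apply is_Cderive_iff. intros eps Heps.
set (M := Cmod z) in *.
(* The error is d^2 / (|w| M^2). The first bound gives |w| > M / 2, and then the second gives d <=
   eps |w| M^2. *)
exists (Rmin (M / 2) (eps * (M * M * M) / 2)). split.
{ apply Rmin_glb_lt; [lra|]. assert (0 < M * M * M) by (repeat apply Rmult_lt_0_compat; lra). nra. }
intros w Hw.
assert (H1 := Rlt_le_trans _ _ _ Hw (Rmin_l _ _)).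
assert (H2 := Rlt_le_trans _ _ _ Hw (Rmin_r _ _)).
set (d := Cmod (w - z)%C) in *.
assert (Hd : 0 <= d) by apply Cmod_ge_0.
assert (Hw2 : M / 2 < Cmod w).
{ assert (H := Cmod_triangle w (- (w - z))%C). rewrite Cmod_opp in H. fold d in H.
  replace (w + - (w - z))%C with z in H by ring. fold M in H. lra. }
assert (Hw0 : w <> RtoC 0) by (apply Cmod_gt_0; lra).
replace (/ w - / z - (w - z) * - (/ z * / z))%C with
  ((w - z) * (w - z) * / (w * (z * z)))%C by (field; split; assumption).
rewrite !Cmod_mult, Cmod_inv, !Cmod_mult by (repeat apply Cmult_neq_0; assumption).
fold d M.
apply Rmult_le_reg_r with (Cmod w * (M * M)); [repeat apply Rmult_lt_0_compat; lra|].
replace (d * d * / (Cmod w * (M * M)) * (Cmod w * (M * M))) with (d * d) by (field; lra).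
rewrite (Rmult_comm eps), Rmult_assoc. apply Rmult_le_compat_l; [assumption|].
apply Rle_trans with (eps * (M * M * M) / 2); [lra|].
assert (0 < eps * (M * M)) by (repeat apply Rmult_lt_0_compat; lra). nra.
Qed.

Lemma is_Cderive_comp (f g : C -> C) (z df dg : C) :
  is_Cderive f (g z) df -> is_Cderive g z dg ->
  is_Cderive (fun x => f (g x)) z (dg * df)%C.
Proof.
intros Hf Hg. apply is_Cderive_AbsRing in Hg.
exact (is_derive_comp (K := C_AbsRing) (V := C_NormedModule) f g z df dg Hf Hg).
Qed.

(** A finite order with explicit derivatives suffices: 3 for harmonicity, less than J for the zero
    at the origin. Closure under sums, products and inverses then settles the extremal function. *)
Fixpoint Cdiff (n : nat) (F : C -> C) : Prop :=
  match n with
  | O => True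
  | S n' => exists F' : C -> C, (forall z, in_disc z -> is_Cderive F z (F' z)) /\ Cdiff n' F'
  end.

Lemma Cdiff_pred n F : Cdiff (S n) F -> Cdiff n F.
Proof.
revert F; induction n as [|n IH]; intros F; [simpl; auto|].
intros [F' [H1 H2]]. exists F'. auto.
Qed.

Lemma Cdiff_const n a : Cdiff n (fun _ => a).
Proof.
revert a; induction n as [|n IH]; intros a; [exact I|].
exists (fun _ => RtoC 0). split; [intros; apply is_Cderive_const|apply IH].
Qed.

Lemma Cdiff_id n : Cdiff n (fun z => z).
Proof.
destruct n as [|n]; [exact I|].
exists (fun _ => RtoC 1). split; [intros; apply is_Cderive_id|apply Cdiff_const].
Qed.

Lemma Cdiff_plus n F G : Cdiff n F -> Cdiff n G -> Cdiff n (fun z => F z + G z)%C.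
Proof.
revert F G; induction n as [|n IH]; intros F G; [auto|].
intros [F' [HF1 HF2]] [G' [HG1 HG2]]. exists (fun z => F' z + G' z)%C.
split; [intros; apply is_Cderive_plus; auto|auto].
Qed.

Lemma Cdiff_mult n F G : Cdiff n F -> Cdiff n G -> Cdiff n (fun z => F z * G z)%C.
Proof.
revert F G; induction n as [|n IH]; intros F G; [auto|].
intros HF HG. assert (HF' := Cdiff_pred _ _ HF). assert (HG' := Cdiff_pred _ _ HG).
destruct HF as [F' [HF1 HF2]], HG as [G' [HG1 HG2]].
exists (fun z => F' z * G z + F z * G' z)%C.
split; [intros; apply is_Cderive_mult; auto|]. apply Cdiff_plus; auto.
Qed.

Lemma Cdiff_pow n j : Cdiff n (fun z => z ^ j)%C.
Proof.
induction j as [|j IH]; [exact (Cdiff_const n (RtoC 1))|].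
exact (Cdiff_mult n _ _ (Cdiff_id n) IH).
Qed.

Lemma is_Cderive_opp (f : C -> C) (z df : C) :
  is_Cderive f z df -> is_Cderive (fun x => - f x)%C z (- df)%C.
Proof. exact (is_derive_opp (K := C_AbsRing) (V := C_NormedModule) f z df). Qed.

Lemma Cdiff_opp n F : Cdiff n F -> Cdiff n (fun z => - F z)%C.
Proof.
revert F; induction n as [|n IH]; intros F; [auto|].
intros [F' [HF1 HF2]]. exists (fun z => - F' z)%C.
split; [intros; apply is_Cderive_opp|]; auto.
Qed.

Lemma Cdiff_inv n F :
  (forall z, in_disc z -> F z <> RtoC 0) -> Cdiff n F -> Cdiff n (fun z => / F z)%C.
Proof.
intros H0; induction n as [|n IH]; [auto|].
intros HF. assert (HI := IH (Cdiff_pred _ _ HF)). destruct HF as [F' [HF1 HF2]].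
exists (fun z => F' z * - (/ F z * / F z))%C. split.
- intros z Hz. apply (is_Cderive_comp Cinv F); [apply is_Cderive_inv|]; auto.
- apply Cdiff_mult; [assumption|]. now apply Cdiff_opp, Cdiff_mult.
Qed.

Lemma in_disc_open (z : C) :
  in_disc z -> exists delta, 0 < delta /\ forall w, Cmod (w - z)%C < delta -> in_disc w.
Proof.
intros Hz. exists (1 - Cmod z). unfold in_disc in *. split; [lra|].
intros w Hw. replace w with ((w - z) + z)%C by ring.
eapply Rle_lt_trans; [apply Cmod_triangle|]. lra.
Qed.

(** Balls of [C_UniformSpace] are squares, where the modulus is below sqrt 2 times the radius; hence
    delta / 2. *)
Lemma locally_C_of_Cmod (z : C) (P : C -> Prop) (delta : R) :
  0 < delta -> (forall w, Cmod (w - z)%C < delta -> P w) -> locally (T := C_UniformSpace) z P.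
Proof.
intros Hd H. assert (Hd2 : 0 < delta / 2) by lra.
exists (mkposreal _ Hd2). intros w Hw. apply H.
eapply Rlt_le_trans; [apply (C_NormedModule_mixin_compat2 z w _ Hw)|]. simpl.
assert (Hs : sqrt 2 <= 2).
{ rewrite <- (sqrt_Rsqr 2) at 2 by lra. apply sqrt_le_1; unfold Rsqr; lra. }
nra.
Qed.

Lemma is_Cderive_ext_disc (f g : C -> C) (z l : C) :
  in_disc z -> (forall w, in_disc w -> f w = g w) -> is_Cderive f z l -> is_Cderive g z l.
Proof.
intros Hz Hfg. destruct (in_disc_open z Hz) as [d [Hd0 Hd]].
apply is_derive_ext_loc. exists (mkposreal d Hd0). intros w Hw. apply Hfg, Hd, Hw.
Qed.

(** Differentiation turns z^(j+1) G into z^j ((j+1) G + z G'). Each step costs the cofactor one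
    order of smoothness, and r counts the orders left. *)
Lemma C_derive_n_zero_of_order (i J : nat) (F G : C -> C) (r : nat) :
  (i <= J)%nat -> Cdiff (i + r) G ->
  (forall z, in_disc z -> F z = (z ^ J * G z)%C) ->
  exists Gi, Cdiff r Gi /\
    forall z, in_disc z -> C_derive_n i F z = (z ^ (J - i) * Gi z)%C.
Proof.
intros HiJ HG HF. revert r HG; induction i as [|i IH]; intros r HG.
- exists G. rewrite Nat.sub_0_r. auto.
- destruct (IH ltac:(lia) (S r)) as [Gi [HGi HE]];
    [now replace (i + S r)%nat with (S i + r)%nat by lia|].
  assert (HGp := Cdiff_pred _ _ HGi). destruct HGi as [Gi' [HD HGi']].
  set (j := (J - S i)%nat). replace (J - i)%nat with (S j) in HE by lia.
  exists (fun z => INR (S j) * Gi z + z * Gi' z)%C. split.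
  + apply Cdiff_plus; apply Cdiff_mult; auto using Cdiff_const, Cdiff_id.
  + intros z Hz. change (C_derive_n (S i) F) with (C_derive (C_derive_n i F)).
    apply is_C_derive_unique.
    apply is_Cderive_ext_disc with (fun w => w ^ S j * Gi w)%C; [assumption| |].
    * intros w Hw. symmetry. now apply HE.
    * replace (z ^ j * (INR (S j) * Gi z + z * Gi' z))%C with
        (INR (S j) * z ^ j * Gi z + z ^ S j * Gi' z)%C by (rewrite Cpow_S; ring).
      apply (is_Cderive_mult (fun w => w ^ S j)%C); [apply is_Cderive_pow|auto].
Qed.

Lemma is_Cderive_partial_x (F : C -> C) (z l : C) :
  is_Cderive F z l -> is_derive (fun t : R => Re (F (t, Im z))) (Re z) (Re l).
Proof.
intros H. apply is_derive_Reals. intros eps Heps.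
assert (Heps2 : 0 < eps / 2) by lra.
destruct (proj1 (is_Cderive_iff F z l) H _ Heps2) as [d [Hd0 Hd]].
exists (mkposreal d Hd0). intros t Ht0 Ht. simpl in Ht.
assert (E : ((Re z + t, Im z)%R - z)%C = RtoC t).
{ unfold Cminus, Cplus, Copp, RtoC, Re, Im; simpl. f_equal; ring. }
specialize (Hd (Re z + t, Im z)). rewrite E, Cmod_R in Hd. specialize (Hd Ht).
assert (Hr := Rle_trans _ _ _ (re_le_Cmod _) Hd).
assert (Hz : (Re z, Im z) = z) by now destruct z. rewrite Hz.
replace ((Re (F ((Re z + t, Im z))) - Re (F z)) / t - Re l) with
  (Re (F (Re z + t, Im z)%R - F z - t * l)%C / t).
2: { unfold Re, Im, Cminus, Cplus, Copp, Cmult, RtoC; simpl. field. assumption. }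
unfold Rdiv. rewrite Rabs_mult, Rabs_inv.
assert (Htp := Rabs_pos_lt _ Ht0).
apply Rmult_lt_reg_r with (Rabs t); [assumption|].
rewrite Rmult_assoc, Rinv_l by lra. nra.
Qed.

Lemma is_Cderive_partial_y (F : C -> C) (z l : C) :
  is_Cderive F z l -> is_derive (fun t : R => Re (F (Re z, t))) (Im z) (Re (Ci * l)%C).
Proof.
intros H.
assert (Hiz : forall w : C, (- Ci * (Ci * w))%C = w).
{ intros w. transitivity (- (Ci * Ci) * w)%C; [ring|].
  replace (Ci * Ci)%C with (- RtoC 1)%C; [ring|].

  unfold Ci, Cmult, Copp, RtoC; simpl. f_equal; ring. }
(* Rotating the plane by a right angle exchanges the two partial derivatives. *)
set (v := (- Ci * z)%C).
assert (HG : is_Cderive (fun w => F (Ci * w)%C) v (Ci * l)%C).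
{ apply (is_Cderive_comp F (fun w => Ci * w)%C).
  - unfold v. replace (Ci * (- Ci * z))%C with (- Ci * (Ci * z))%C by ring. now rewrite Hiz.
  - assert (H1 := is_Cderive_mult _ _ v _ _ (is_Cderive_const Ci v) (is_Cderive_id v)).
    cbv beta in H1. now replace (0 * v + Ci * 1)%C with Ci in H1 by ring. }
apply is_Cderive_partial_x in HG.
assert (Ev : Re v = Im z) by (unfold v, Re, Im; simpl; ring).
assert (Ev' : Im v = - Re z) by (unfold v, Re, Im; simpl; ring).
rewrite Ev, Ev' in HG.
apply is_derive_ext with (2 := HG). intros t. do 2 f_equal.
unfold Ci, Cmult; simpl. f_equal; ring.
Qed.

Definition agrees_Re (u : C -> R) (F : C -> C) : Prop :=
  forall z, in_disc z -> u z = Re (F z).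

Lemma is_derive_horizontal (u : C -> R) (F : C -> C) (z l : C) :
  agrees_Re u F -> in_disc z -> is_Cderive F z l ->
  is_derive (fun t : R => u (t, Im z)) (Re z) (Re l).
Proof.
intros Hu Hz HF. destruct (in_disc_open z Hz) as [d [Hd0 Hd]].
apply (is_derive_ext_loc (fun t : R => Re (F (t, Im z)))).
- exists (mkposreal d Hd0). intros t Ht. symmetry. apply Hu, Hd.
  assert (E : ((t, Im z) - z)%C = RtoC (t - Re z))
    by (unfold Cminus, Cplus, Copp, RtoC, Re, Im; simpl; f_equal; ring).
  change (Cmod ((t, Im z) - z)%C < d). rewrite E, Cmod_R. exact Ht.
- now apply is_Cderive_partial_x.
Qed.

Lemma is_derive_vertical (u : C -> R) (F : C -> C) (z l : C) :
  agrees_Re u F -> in_disc z -> is_Cderive F z l ->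
  is_derive (fun t : R => u (Re z, t)) (Im z) (Re (Ci * l)%C).
Proof.
intros Hu Hz HF. destruct (in_disc_open z Hz) as [d [Hd0 Hd]].
apply (is_derive_ext_loc (fun t : R => Re (F (Re z, t)))).
- exists (mkposreal d Hd0). intros t Ht. symmetry. apply Hu, Hd.
  assert (E : ((Re z, t) - z)%C = (Ci * RtoC (t - Im z))%C)
    by (unfold Cminus, Cplus, Copp, Cmult, Ci, RtoC, Re, Im; simpl; f_equal; ring).
  change (Cmod ((Re z, t) - z)%C < d).
  rewrite E, Cmod_mult, Cmod_Ci, Cmod_R, Rmult_1_l. exact Ht.
- now apply is_Cderive_partial_y.
Qed.

Lemma agrees_Re_continuous (u : C -> R) (F : C -> C) (z l : C) :
  agrees_Re u F -> in_disc z -> is_Cderive F z l -> continuous u z.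
Proof.
intros Hu Hz HF. apply filterlim_locally. intros eps.
destruct (in_disc_open z Hz) as [d [Hd0 Hd]].
destruct (proj1 (is_Cderive_iff F z l) HF 1 Rlt_0_1) as [d' [Hd0' Hd']].
assert (Hl := Cmod_ge_0 l). assert (He := cond_pos eps).
set (e := eps / (2 + Cmod l)).
assert (He0 : 0 < e) by (apply Rdiv_lt_0_compat; lra).
apply (locally_C_of_Cmod z _ (Rmin d (Rmin d' e))).
- repeat apply Rmin_glb_lt; assumption.
- intros w Hw.
  assert (H1 := Rlt_le_trans _ _ _ Hw (Rmin_l _ _)).
  assert (H2 := Rlt_le_trans _ _ _ Hw (Rmin_r _ _)).
  assert (H3 := Rlt_le_trans _ _ _ H2 (Rmin_l _ _)).
  assert (H4 := Rlt_le_trans _ _ _ H2 (Rmin_r _ _)).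
  change (Rabs (u w - u z) < eps).
  rewrite (Hu z Hz), (Hu w (Hd w H1)).
  apply Rle_lt_trans with (Cmod (F w - F z)%C); [exact (re_le_Cmod (F w - F z)%C)|].
  replace (F w - F z)%C with ((F w - F z - (w - z) * l) + (w - z) * l)%C by ring.
  eapply Rle_lt_trans; [apply Cmod_triangle|]. rewrite Cmod_mult.
  specialize (Hd' w H3). set (s := Cmod (w - z)%C) in *.
  assert (Hs : 0 <= s) by apply Cmod_ge_0.
  apply Rle_lt_trans with (s * (2 + Cmod l)); [nra|].
  apply Rlt_le_trans with (e * (2 + Cmod l)); [apply Rmult_lt_compat_r; lra|].
  right. unfold e. field. lra.
Qed.

(** The partial derivatives of Re F are Re F' and Re (i F'), again real parts of differentiable
    functions, so the lemma can be applied to them in turn. *)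
Lemma agrees_Re_C1 (u : C -> R) (F F' : C -> C) :
  agrees_Re u F -> (forall z, in_disc z -> is_Cderive F z (F' z)) -> Cdiff 1 F' ->
  C1_in_disc u /\ agrees_Re (partial_x u) F' /\ agrees_Re (partial_y u) (fun z => Ci * F' z)%C.
Proof.
intros Hu HF [F'' [HF' _]].
assert (Hx : agrees_Re (partial_x u) F').
{ intros z Hz. apply is_derive_unique. exact (is_derive_horizontal u F z _ Hu Hz (HF z Hz)). }
assert (Hy : agrees_Re (partial_y u) (fun z => Ci * F' z)%C).
{ intros z Hz. apply is_derive_unique. exact (is_derive_vertical u F z _ Hu Hz (HF z Hz)). }
split; [|now split]. intros z Hz. repeat split.
- eexists. exact (is_derive_horizontal u F z _ Hu Hz (HF z Hz)).
- eexists. exact (is_derive_vertical u F z _ Hu Hz (HF z Hz)).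
- exact (agrees_Re_continuous _ F' z _ Hx Hz (HF' z Hz)).
- exact (agrees_Re_continuous _ _ z _ Hy Hz
    (is_Cderive_mult _ _ z _ _ (is_Cderive_const Ci z) (HF' z Hz))).
Qed.

(** The second derivatives Re F'' and Re (i^2 F'') cancel; the third order of [Cdiff] serves the
    continuity of second partial derivatives. *)
Lemma Re_harmonic (F : C -> C) : Cdiff 3 F -> real_harmonic_in_disc (fun z => Re (F z)).
Proof.
intros [F' [HF [F'' [HF' HF'']]]].
assert (HF1 : Cdiff 1 F') by (exists F''; split; [assumption|exact I]).
destruct (agrees_Re_C1 (fun z => Re (F z)) F F' (fun z _ => eq_refl) HF HF1) as [HC [Hx Hy]].
destruct (agrees_Re_C1 _ F' F'' Hx HF' HF'') as [HCx [Hxx _]].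
assert (HiF' : forall z, in_disc z -> is_Cderive (fun z => Ci * F' z)%C z (Ci * F'' z)%C).
{ intros z Hz. replace (Ci * F'' z)%C with (0 * F' z + Ci * F'' z)%C by ring.
  exact (is_Cderive_mult _ _ z _ _ (is_Cderive_const Ci z) (HF' z Hz)). }
destruct (agrees_Re_C1 _ _ (fun z => Ci * F'' z)%C Hy HiF'
  (Cdiff_mult 1 _ _ (Cdiff_const 1 Ci) HF'')) as [HCy [_ Hyy]].
split; [exact HC|split; [exact HCx|split; [exact HCy|]]].
intros z Hz. rewrite (Hxx z Hz), (Hyy z Hz). unfold Re, Ci, Cmult; simpl. ring.
Qed.

(** * The extremal function *)

Definition mobius (al : R) (w : C) : C := ((al - w) * / (1 + - al * w))%C.

(** Read off from [mobius al w] = al - (1 - al^2) w / (1 - al w). *)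
Definition mobius_coeff (al : R) (j : nat) : R :=
  match j with O => al | S i => - ((1 - al ^ 2) * al ^ i) end.

Lemma mobius_denom (al : R) (w : C) :
  0 <= al < 1 -> Cmod w <= 1 -> (1 + - al * w)%C <> RtoC 0.
Proof.
intros Hal Hw H.
assert (E : (al * w)%C = RtoC 1).
{ transitivity (1 - (1 + - al * w))%C; [ring|]. rewrite H. ring. }
apply (f_equal Cmod) in E. rewrite Cmod_mult, Cmod_1, Cmod_R, Rabs_right in E by lra.
assert (H0 := Cmod_ge_0 w). nra.
Qed.

Lemma Cmod_mobius_le_1 (al : R) (w : C) :
  0 <= al < 1 -> Cmod w <= 1 -> Cmod (mobius al w) <= 1.
Proof.
intros Hal Hw. assert (Hd := mobius_denom al w Hal Hw).
assert (Hd' := proj1 (Cmod_gt_0 _) Hd).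
unfold mobius. rewrite Cmod_mult, Cmod_inv by assumption.
apply Rmult_le_reg_r with (1 := Hd'). rewrite Rmult_assoc, Rinv_l, Rmult_1_r, Rmult_1_l by lra.
apply Rsqr_incr_0; [|apply Cmod_ge_0|apply Cmod_ge_0].
rewrite !Rsqr_pow2, !Cmod2_alt.
assert (Hw2 : Re w ^ 2 + Im w ^ 2 <= 1).
{ rewrite <- Cmod2_alt. assert (H0 := Cmod_ge_0 w). nra. }
destruct w as [u v]. unfold Re, Im in *. simpl in *.
(* The identity |1 - al w|^2 - |al - w|^2 = (1 - al^2) (1 - |w|^2). *)
assert (0 <= (1 - al * al) * (1 - (u * u + v * v))) by (apply Rmult_le_pos; nra). nra.
Qed.

Lemma Csum_mobius_coeff (al : R) (w : C) (n : nat) :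
  (1 + - al * w)%C <> RtoC 0 ->
  (Csum (fun j => mobius_coeff al j * w ^ j) n - mobius al w)%C =
  (RtoC ((1 - al ^ 2) * al ^ n) * w ^ S n * / (1 + - al * w))%C.
Proof.
intros Hd. unfold mobius. induction n as [|n IH].
- rewrite Csum_O, pow_O, Rmult_1_r, Cpow_1_r, RtoC_minus, RtoC_pow.
  change (mobius_coeff al 0) with al. change (w ^ 0)%C with (RtoC 1). field. assumption.
- rewrite Csum_S.
  transitivity ((Csum (fun j => mobius_coeff al j * w ^ j) n -
    (al - w) * / (1 + - al * w)) + mobius_coeff al (S n) * w ^ S n)%C; [ring|].
  rewrite IH. unfold mobius_coeff. set (b := 1 - al ^ 2).
  rewrite <- (tech_pow_Rmult al n), (Cpow_S w (S n)), RtoC_opp, !RtoC_mult.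
  field. assumption.
Qed.

Lemma is_series_mobius (al : R) (w : C) :
  0 <= al < 1 -> Cmod w < 1 ->
  is_series (K := C_AbsRing) (V := C_NormedModule)
    (fun j => mobius_coeff al j * w ^ j)%C (mobius al w).
Proof.
intros Hal Hw. assert (Hd := mobius_denom al w Hal (Rlt_le _ _ Hw)).
assert (Hd' := proj1 (Cmod_gt_0 _) Hd).
assert (Hw0 := Cmod_ge_0 w).
apply is_series_C_iff. intros eps Heps.
destruct (pow_lt_1_zero (Cmod w) ltac:(rewrite Rabs_right; lra)
            (eps * Cmod (1 + - al * w)%C) ltac:(now apply Rmult_lt_0_compat)) as [n0 Hn0].
exists n0. intros n Hn. rewrite Csum_mobius_coeff by assumption.
specialize (Hn0 (S n) ltac:(lia)).
assert (Hp : 0 <= Cmod w ^ S n) by (apply pow_le; assumption).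
rewrite Rabs_right in Hn0 by lra.
rewrite !Cmod_mult, Cmod_inv, Cmod_pow by assumption.
assert (Ha : 0 <= al ^ n <= 1).
{ split; [apply pow_le; lra|]. rewrite <- (pow1 n). apply pow_incr; lra. }
assert (Ha2 : 0 <= 1 - al ^ 2 <= 1) by nra.
assert (Hq : 0 <= (1 - al ^ 2) * al ^ n <= 1) by nra.
rewrite Cmod_R, Rabs_right by lra.
apply Rmult_lt_reg_r with (1 := Hd'). rewrite Rmult_assoc, Rinv_l, Rmult_1_r by lra.
eapply Rle_lt_trans; [|exact Hn0]. rewrite <- (Rmult_1_l (Cmod w ^ S n)) at 2.
apply Rmult_le_compat_r; lra.
Qed.

Lemma Series_geom_mult (b q : R) :
  0 <= q < 1 -> ex_series (fun i => b * q ^ i) /\ Series (fun i => b * q ^ i) = b / (1 - q).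
Proof.
intros Hq. assert (Hq' : Rabs q < 1) by (rewrite Rabs_right; lra). split.
- apply (ex_series_scal_l (K := R_AbsRing) b (fun i => q ^ i)). now apply ex_series_geom.
- now rewrite Series_scal_l, Series_geom.
Qed.

(* The Möbius coefficients give equality in [bohr_refined]. *)
Lemma bohr_mobius (al x : R) (c : nat -> C) :
  0 <= al < 1 -> 0 <= x < 1 -> (forall j, c j = RtoC (mobius_coeff al j)) ->
  Series (fun j => Cmod (c j) * x ^ j) +
  bohr_weight c x * Series (fun j => Cmod (c (S j)) ^ 2 * x ^ (2 * S j)) =
  al + (1 - al ^ 2) * (x / (1 - x)).
Proof.
intros Hal Hx Hc.
assert (Hax : 0 <= al * x < 1) by nra.
assert (Hax2 : 0 <= (al * x) ^ 2 < 1) by nra.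
assert (Ha2 : 0 <= 1 - al ^ 2) by nra.
assert (E0 : Cmod (c 0%nat) = al) by (rewrite Hc, Cmod_R, Rabs_right; simpl; lra).
assert (E : forall j, Cmod (c (S j)) = (1 - al ^ 2) * al ^ j).
{ intros j. rewrite Hc, Cmod_R. simpl mobius_coeff.
  assert (0 <= al ^ j) by (apply pow_le; lra). rewrite Rabs_Ropp, Rabs_right; nra. }
destruct (Series_geom_mult ((1 - al ^ 2) * x) (al * x) Hax) as [X1 S1].
destruct (Series_geom_mult ((1 - al ^ 2) ^ 2 * x ^ 2) ((al * x) ^ 2) Hax2) as [_ S2].
assert (E1 : forall j, (1 - al ^ 2) * x * (al * x) ^ j = Cmod (c (S j)) * x ^ S j).
{ intros j. rewrite E, Rpow_mult_distr. simpl. ring. }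
rewrite Series_incr_1.
2: { apply ex_series_incr_1. now apply (ex_series_ext _ _ E1). }
rewrite <- (Series_ext _ _ E1), S1.
rewrite (Series_ext _ (fun i => (1 - al ^ 2) ^ 2 * x ^ 2 * ((al * x) ^ 2) ^ i)).
2: { intros j. rewrite E, <- pow_mult, !Rpow_mult_distr.
     replace (2 * S j)%nat with (2 * j + 2)%nat by lia.
     rewrite pow_add, <- !pow_mult, (Nat.mul_comm 2 j). ring. }
rewrite S2. unfold bohr_weight. rewrite E0. simpl (x ^ 0).
field. repeat split; nra.
Qed.

Definition extremal (J p : nat) (al : R) (z : C) : C := (z ^ J * mobius al (z ^ p))%C.

Lemma in_disc_pow (z : C) (p : nat) : (1 <= p)%nat -> in_disc z -> in_disc (z ^ p)%C.
Proof.
unfold in_disc. intros Hp Hz. rewrite Cmod_pow.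
apply pow_lt_1_compat; [|lia]. split; [apply Cmod_ge_0|assumption].
Qed.

Lemma Cdiff_mobius_pow (al : R) (p n : nat) :
  (1 <= p)%nat -> 0 <= al < 1 -> Cdiff n (fun z => mobius al (z ^ p)%C).
Proof.
intros Hp Hal.
apply (Cdiff_mult n (fun z => al - z ^ p)%C (fun z => / (1 + - al * z ^ p))%C).
- apply (Cdiff_plus n (fun _ => RtoC al) (fun z => - z ^ p)%C); [apply Cdiff_const|].
  apply (Cdiff_opp n (fun z => z ^ p)%C). apply Cdiff_pow.
- apply (Cdiff_inv n (fun z => 1 + - al * z ^ p)%C).
  + intros z Hz. apply mobius_denom; [assumption|]. now apply Rlt_le, in_disc_pow.
  + apply (Cdiff_plus n (fun _ => RtoC 1) (fun z => - al * z ^ p)%C); [apply Cdiff_const|].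
    exact (Cdiff_mult n _ _ (Cdiff_const n (- al)%C) (Cdiff_pow n p)).
Qed.

Lemma Cdiff_extremal (J p n : nat) (al : R) :
  (1 <= p)%nat -> 0 <= al < 1 -> Cdiff n (extremal J p al).
Proof.
intros Hp Hal. apply (Cdiff_mult n (fun z => z ^ J)%C); [apply Cdiff_pow|].
now apply Cdiff_mobius_pow.
Qed.

Lemma class_Bj_extremal (J p : nat) (al : R) :
  (1 <= p)%nat -> 0 <= al < 1 -> class_Bj J (extremal J p al).
Proof.
intros Hp Hal. split; [split|].
- intros z Hz. destruct (Cdiff_extremal J p 1 al Hp Hal) as [F' [HF _]].
  exists (F' z). now apply HF.
- intros z Hz. unfold extremal. rewrite Cmod_mult, Cmod_pow.
  assert (H1 := Cmod_mobius_le_1 al (z ^ p)%C Hal (Rlt_le _ _ (in_disc_pow z p Hp Hz))).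
  assert (H2 : 0 <= Cmod z ^ J <= 1).
  { split; [apply pow_le, Cmod_ge_0|]. rewrite <- (pow1 J). apply pow_incr.
    split; [apply Cmod_ge_0|now apply Rlt_le]. }
  assert (H3 := Cmod_ge_0 (mobius al (z ^ p)%C)). nra.
- intros i Hi.
  destruct (C_derive_n_zero_of_order i J (extremal J p al) (fun z => mobius al (z ^ p)%C) 0
              (Nat.lt_le_incl _ _ Hi)) as [Gi [_ HG]].
  + now apply Cdiff_mobius_pow.
  + reflexivity.
  + rewrite HG by (unfold in_disc; rewrite Cmod_0; lra).
    destruct (J - i)%nat as [|d] eqn:Ed; [lia|]. rewrite Cpow_S. ring.
Qed.

(** Recovers j from n = p * (k + j) + m; at other indices the value is arbitrary. *)
Definition extremal_coeff (k m p : nat) (al : R) (n : nat) : C :=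
  RtoC (mobius_coeff al ((n - m) / p - k)).

Lemma extremal_coeff_eq (k m p : nat) (al : R) (j : nat) :
  (1 <= p)%nat -> extremal_coeff k m p al (p * (k + j) + m) = RtoC (mobius_coeff al j).
Proof.
intros Hp. unfold extremal_coeff. do 2 f_equal.
rewrite Nat.add_sub, Nat.mul_comm, Nat.div_mul by lia. lia.
Qed.

Lemma has_expansion_extremal (k m p : nat) (al : R) :
  (1 <= p)%nat -> 0 <= al < 1 ->
  has_expansion k m p (extremal_coeff k m p al) (extremal (p * k + m) p al).
Proof.
intros Hp Hal z Hz.
apply (is_series_ext (fun j => scal (z ^ (p * k + m))%C (mobius_coeff al j * (z ^ p) ^ j)%C)).
- intros j. rewrite extremal_coeff_eq by assumption.
  replace (z ^ (p * (k + j) + m))%C with (z ^ (p * k + m) * (z ^ p) ^ j)%C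
    by (rewrite <- Cpow_mult_r, <- Cpow_add_r; f_equal; lia).
  change (z ^ (p * k + m) * (mobius_coeff al j * (z ^ p) ^ j) =
          mobius_coeff al j * (z ^ (p * k + m) * (z ^ p) ^ j))%C. ring.
- apply (is_series_scal_l (K := C_AbsRing) (V := C_NormedModule)).
  apply is_series_mobius; [assumption|]. now apply in_disc_pow.
Qed.

(** With g = h the function f is 2 Re h, so [Re_harmonic] applies to its real part and, with the
    constant 0, to its imaginary part. *)
Lemma admissible_extremal (k m p : nat) (al : R) :
  (1 <= p)%nat -> 0 <= al < 1 ->
  let a := extremal_coeff k m p al in
  let h := extremal (p * k + m) p al in
  admissible k m p a a (fun z => RtoC (Re (h z + h z)%C)) h h.
Proof.
intros Hp Hal a h.
assert (Hexp := has_expansion_extremal k m p al Hp Hal).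
assert (HB := class_Bj_extremal (p * k + m) p al Hp Hal).
split; [split|split; [|exact (conj Hexp (conj Hexp (conj HB HB)))]].
- apply (Re_harmonic (fun z => h z + h z)%C). now apply Cdiff_plus; apply Cdiff_extremal.
- apply (Re_harmonic (fun _ => RtoC 0)). apply Cdiff_const.
- intros z _. destruct (h z) as [u v].
  unfold RtoC, Re, Cplus, Cconj; simpl. f_equal; ring.
Qed.

(** If x = tau^p were at most 1/3, then 5 x^2 - 2 x + 1 <= 1 and, as k >= 2, its coefficient is at
    most x, so the subtracted product is at most 1/3 while 2 (1 - x) >= 4/3. *)
Lemma tau_pow_gt (k m p : nat) (tau : R) :
  (2 <= k)%nat -> is_root_tau k m p tau -> 1 / 3 < tau ^ p.
Proof.
intros Hk [Htau Hroot]. apply Rnot_le_lt. intros Hx.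
rewrite (Nat.mul_comm 2 p), pow_mult in Hroot.
assert (H1 : tau ^ (p * (k - 1) + m) <= tau ^ p).
{ replace (p * (k - 1) + m)%nat with (p + (p * (k - 2) + m))%nat.
  - rewrite pow_add.
    assert (0 < tau ^ p) by (apply pow_lt; lra).
    assert (0 <= tau ^ (p * (k - 2) + m) <= 1).
    { split; [apply pow_le; lra|]. rewrite <- (pow1 (p * (k - 2) + m)). apply pow_incr; lra. }
    nra.
  - replace (k - 1)%nat with (1 + (k - 2))%nat by lia. lia. }
assert (H2 : 0 < tau ^ (p * (k - 1) + m)) by (apply pow_lt; lra).
assert (H3 : 0 < tau ^ p) by (apply pow_lt; lra).
set (x := tau ^ p) in *. set (y := tau ^ (p * (k - 1) + m)) in *.
assert (H4 : 5 * x ^ 2 - 2 * x + 1 <= 1) by nra.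
assert (H5 : y * (5 * x ^ 2 - 2 * x + 1) <= y * 1) by (apply Rmult_le_compat_l; lra).
lra.
Qed.

Lemma bohr_fails_beyond_tau (k m p : nat) (tau rho : R) :
  (2 <= k)%nat -> (1 <= p)%nat -> is_root_tau k m p tau -> tau < rho < 1 ->
  ~ bohr_inequality_upto k m p rho.
Proof.
intros Hk Hp Hroot Hrho HB.
assert (Hx3 := tau_pow_gt k m p tau Hk Hroot). destruct Hroot as [Htau Hroot].
assert (HF := tau_fun_decreasing k m p tau rho Hk Hp ltac:(lra) ltac:(lra)).
change (tau_fun k m p tau = 0) in Hroot. rewrite Hroot in HF.
assert (Hx1 := pow_lt_mono tau rho p ltac:(lra) Hp).
assert (Hx2 : rho ^ p < 1) by (apply pow_lt_1_compat; [lra|lia]).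
set (x := rho ^ p) in *.
set (al := (1 - x) / (2 * x)).
assert (Hal : 0 <= al < 1).
{ unfold al. split; [apply Rdiv_le_0_compat; lra|].
  apply Rmult_lt_reg_r with (2 * x); [lra|]. unfold Rdiv. rewrite Rmult_assoc, Rinv_l; lra. }
assert (H := HB _ _ _ _ _ (admissible_extremal k m p al Hp Hal) rho ltac:(lra)).
rewrite M1_factor in H. fold x in H. cbv beta in H.
rewrite (bohr_mobius al x (fun j => extremal_coeff k m p al (p * (k + j) + m))) in H
  by (try lra; intros; now apply extremal_coeff_eq).
replace (al + (1 - al ^ 2) * (x / (1 - x))) with
  ((5 * x ^ 2 - 2 * x + 1) / (4 * x * (1 - x))) in H by (unfold al; field; lra).
unfold tau_fun in HF. rewrite (Nat.mul_comm 2 p), pow_mult in HF. fold x in HF.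
replace (p * k + m)%nat with (p + (p * (k - 1) + m))%nat in H.
2: { destruct k; [lia|]. simpl Nat.sub. rewrite Nat.sub_0_r. lia. }
rewrite pow_add in H. fold x in H. set (y := rho ^ (p * (k - 1) + m)) in *.
apply (Rmult_le_compat_r (2 * (1 - x))) in H; [|lra].
replace ((x * y * ((5 * x ^ 2 - 2 * x + 1) / (4 * x * (1 - x))) +
  x * y * ((5 * x ^ 2 - 2 * x + 1) / (4 * x * (1 - x)))) * (2 * (1 - x)))
  with (y * (5 * x ^ 2 - 2 * x + 1)) in H by (field; lra).
lra.
Qed.

Theorem theorem4 (k m p : nat) (hk : (2 <= k)%nat) (hm : (1 <= m)%nat)
    (hp : (1 <= p)%nat) (hmp : (m <= p)%nat) :
  exists tau : R,
    unique (is_root_tau k m p) tau /\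
    bohr_inequality_upto k m p tau /\
    (forall rho : R, tau < rho < 1 -> ~ bohr_inequality_upto k m p rho).
Proof.
destruct (tau_exists k m p hp hm) as [tau Htau]. exists tau. split; [|split].
- split; [assumption|]. intros t Ht.
  destruct Htau as [Htau Hroot], Ht as [Ht Hroot'].
  change (tau_fun k m p tau = 0) in Hroot. change (tau_fun k m p t = 0) in Hroot'.
  destruct (Rtotal_order tau t) as [L|[E|L]]; [|exact E|].
  + assert (H := tau_fun_decreasing k m p tau t hk hp ltac:(lra) ltac:(lra)). lra.
  + assert (H := tau_fun_decreasing k m p t tau hk hp ltac:(lra) ltac:(lra)). lra.
- now apply bohr_upto_tau.
- intros rho Hrho. now apply bohr_fails_beyond_tau with tau.
Qed.
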